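(* Let $o\in\{\mathrm{dn},\mathrm{up}\}$ denote the terrestrial transmission mode sharing spectrum with the uplink (UL) satellite network. Then the ergodic spectral efficiency $R_{\mathrm{up}}^{o}=\mathbb{E}[\log_2(1+\mathrm{SINR}_{\mathrm{up}}^{o})]$ of the UL satellite network is $$R_{\mathrm{up}}^{o}=\Bigl(1-e^{-\tilde\lambda_{\mathrm{u_s|s}}\pi\left((R_{\max}^{\mathrm{u_s|s}})^2-(R_{\min}^{\mathrm{u_s|s}})^2\right)}\Bigr)\int_0^\infty\int_{R_{\min}^{\mathrm{u_s|s}}}^{R_{\max}^{\mathrm{u_s|s}}}\Biggl[1-\sum_{z=0}^{m_{\mathrm s}-1}\frac{\zeta(z)\Gamma(z+1)}{(\beta-c)^{z+1}}\Biggl(1-\sum_{v=0}^{z}\frac{((\beta-c)\gamma r^{\alpha_{\mathrm s}})^v}{(G_1^{\mathrm{u_s|s}}P_{\mathrm{u_s}})^v\,v!}(-1)^v\frac{\mathrm d^v\mathcal L_r^{o}(s)}{\mathrm ds^v}\bigg|_{s=\frac{(\beta-c)\gamma r^{\alpha_{\mathrm s}}}{G_1^{\mathrm{u_s|s}}P_{\mathrm{u_s}}}}\Biggr)\Biggr]f(r)\,\frac{\log_2 e}{1+\gamma}\,\mathrm dr\,\mathrm d\gamma,$$ where $f$ is the conditional density of the distance $\|\mathbf u_1^{\mathrm s}-\mathbf x_1\|$ from the typical satellite to the nearest satellite user given that at least one satellite user is visible, and $\mathcal L_r^{o}$ is the conditional Laplace transform of the aggregated interference plus noise power $I_{\mathrm{up}}^{o}(r)$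 given that at least one satellite user is visible and that this nearest distance equals $r$.
   Context: Geometry. All nodes lie on spheres centered at the origin of $\mathbb{R}^3$. Satellites lie on the sphere of radius $R_{\mathrm s}$; satellite users, terrestrial base stations (BSs) and terrestrial users lie on spheres of radii $R_{\mathrm{u_s}},R_{\mathrm b},R_{\mathrm{u_t}}<R_{\mathrm s}$. $\Phi_{\mathrm{u_s}}=\{\mathbf u_\ell^{\mathrm s}\}$, $\Phi_{\mathrm b}=\{\mathbf b_m\}$, $\Phi_{\mathrm{u_t}}=\{\mathbf u_k^{\mathrm t}\}$ are mutually independent homogeneous Poisson point processes on the respective spheres with densities $\lambda_{\mathrm{u_s}},\lambda_{\mathrm b},\lambda_{\mathrm{u_t}}>0$ (per unit area). The typical satellite is fixed at $\mathbf x_1=(0,0,R_{\mathrm s})$. The visible angle is $\theta_{\mathrm s}\in(0,\pi/2)$ with $R_{\mathrm s}\sin\theta_{\mathrm s}\le R_o$ for $o\in\{\mathrm{u_s},\mathrm b,\mathrm{u_t}\}$. For such $o$ put $$R_{\min}^{o|\mathrm s}=R_{\mathrm s}-R_o,\quad R_{\max}^{o|\mathrm s}=R_{\mathrm s}\cos\theta_{\mathrm s}-\sqrt{R_o^2-R_{\mathrm s}^2\sin^2\theta_{\mathrm s}},\quad \tilde\lambda_{o|\mathrm s}=\lambda_o\frac{R_o}{R_{\mathrm s}}.$$ The visible cap $\mathcal A_{o|\mathrm s}$ is the set of points of the sphere of radius $R_o$ at distance at most $R_{\max}^{o|\mathrm s}$ from $\mathbf x_1$; $\mathcal A_{o|\mathrm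 s}(r)$ is the set of those at distance at most $r$. ''At least one satellite user is visible'' is the event $\Phi_{\mathrm{u_s}}(\mathcal A_{\mathrm{u_s|s}})\ge1$; $\mathbf u_1^{\mathrm s}$ is the visible satellite user nearest to $\mathbf x_1$, which is the served one. Gains. With carrier frequency $f_c$, speed of light $c_0$ and positive lobe gains: $G_1^{\mathrm{u_s|s}}=G_{\mathrm s}^{\mathrm{main}}G_{\mathrm{u_s}}^{\mathrm{main}}(c_0/4\pi f_c)^2$; $G_\ell^{\mathrm{u_s|s}}=G_{\mathrm s}^{\mathrm{side}}G_{\mathrm{u_s}}^{\mathrm{side}}(c_0/4\pi f_c)^2$ for $\ell\ne1$; $G^{\mathrm{u_t|s}}=G_{\mathrm s}^{\mathrm{side}}G_{\mathrm{u_t}}^{\mathrm{side}}(c_0/4\pi f_c)^2$; and for a BS, $G^{\mathrm{b|s}}=G_{\mathrm s}^{\mathrm{side}}G_{\mathrm b}^{\mathrm{side}}(c_0/4\pi f_c)^2$, where $G_{\mathrm b}^{\mathrm{side}}=G_{\mathrm{b_H}}^{\mathrm{side}}$ if the elevation angle $\psi$ of $\mathbf x_1$ above the local horizontal plane at the BS satisfies $\psi_1^{\mathrm{th}}<\psi\le\psi_2^{\mathrm{th}}$ and $G_{\mathrm b}^{\mathrm{side}}=G_{\mathrm{b_L}}^{\mathrm{side}}$ if $\psi>\psi_2^{\mathrm{th}}$. It is assumed that $\psi_1^{\mathrm{th}}<\cos^{-1}\bigl(\tfrac{R_{\mathrm s}}{R_{\mathrm b}}\sin\theta_{\mathrm s}\bigr)$,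 so every visible BS has $\psi>\psi_1^{\mathrm{th}}$. Fading. All satellite-link fading powers $H^{\mathrm s}$ (with different indices, for satellite users, BSs and terrestrial users) are i.i.d. and independent of the point processes; $\sqrt{H^{\mathrm s}}$ is Shadowed-Rician with density $$\Bigl(\tfrac{2bm_{\mathrm s}}{2bm_{\mathrm s}+\Omega}\Bigr)^{m_{\mathrm s}}\tfrac{x}{b}\,e^{-x^2/(2b)}\,{}_1F_1\Bigl(m_{\mathrm s};1;\tfrac{\Omega x^2}{2b(2bm_{\mathrm s}+\Omega)}\Bigr),\quad x>0,$$ with $b,\Omega>0$, $m_{\mathrm s}$ a positive integer, ${}_1F_1$ the confluent hypergeometric function. Constants: $\beta=\frac1{2b}$, $c=\frac{\Omega}{2b(2bm_{\mathrm s}+\Omega)}$, $\zeta(z)=\bigl(\frac{2bm_{\mathrm s}}{2bm_{\mathrm s}+\Omega}\bigr)^{m_{\mathrm s}}\frac{\beta(-1)^z(1-m_{\mathrm s})_z c^z}{(z!)^2}$, with $(x)_z=x(x+1)\cdots(x+z-1)$ and $(x)_0=1$. Signals. $P_{\mathrm{u_s}},P_{\mathrm b},P_{\mathrm{u_t}}>0$ are transmit powers, $\sigma^2>0$ noise power, $\alpha_{\mathrm s}>0$ the path-loss exponent. On the event that a satellite user is visible, $$\mathrm{SINR}_{\mathrm{up}}^{o}=\frac{G_1^{\mathrm{u_s|s}}P_{\mathrm{u_s}}H_1^{\mathrm s}\|\mathbf u_1^{\mathrm s}-\mathbf x_1\|^{-\alpha_{\mathrm s}}}{I_{\mathrm s}^{\mathrm{up}}+I_{\mathrm{t,up}}^{o}+\sigma^2},$$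 with $I_{\mathrm s}^{\mathrm{up}}=\sum_{\mathbf u_\ell^{\mathrm s}\in(\Phi_{\mathrm{u_s}}\cap\mathcal A_{\mathrm{u_s|s}})\setminus\{\mathbf u_1^{\mathrm s}\}}G_\ell^{\mathrm{u_s|s}}P_{\mathrm{u_s}}H_\ell^{\mathrm s}\|\mathbf u_\ell^{\mathrm s}-\mathbf x_1\|^{-\alpha_{\mathrm s}}$, $I_{\mathrm{t,up}}^{\mathrm{dn}}=\sum_{\mathbf b_m\in\Phi_{\mathrm b}\cap\mathcal A_{\mathrm{b|s}}}G^{\mathrm{b|s}}P_{\mathrm b}H_m^{\mathrm s}\|\mathbf b_m-\mathbf x_1\|^{-\alpha_{\mathrm s}}$, $I_{\mathrm{t,up}}^{\mathrm{up}}=\sum_{\mathbf u_k^{\mathrm t}\in\Phi_{\mathrm{u_t}}\cap\mathcal A_{\mathrm{u_t|s}}}G^{\mathrm{u_t|s}}P_{\mathrm{u_t}}H_k^{\mathrm s}\|\mathbf u_k^{\mathrm t}-\mathbf x_1\|^{-\alpha_{\mathrm s}}$. If no satellite user is visible, $\mathrm{SINR}_{\mathrm{up}}^{o}=0$. For $\|\mathbf u_1^{\mathrm s}-\mathbf x_1\|=r$, $I_{\mathrm{up}}^{o}(r)=\sum_{\mathbf u_\ell^{\mathrm s}\in\Phi_{\mathrm{u_s}}\cap(\mathcal A_{\mathrm{u_s|s}}\setminus\mathcal A_{\mathrm{u_s|s}}(r))}G_\ell^{\mathrm{u_s|s}}P_{\mathrm{u_s}}H_\ell^{\mathrm s}\|\mathbf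 u_\ell^{\mathrm s}-\mathbf x_1\|^{-\alpha_{\mathrm s}}+I_{\mathrm{t,up}}^{o}+\sigma^2$ (all gains in this sum are the side-lobe ones), and $\mathcal L_r^{o}(s)=\mathbb E\bigl[e^{-sI_{\mathrm{up}}^{o}(r)}\,\big|\,\|\mathbf u_1^{\mathrm s}-\mathbf x_1\|=r,\ \Phi_{\mathrm{u_s}}(\mathcal A_{\mathrm{u_s|s}})\ge1\bigr]$. *)

(* Defs.v *)
From HB Require Import structures.
From mathcomp Require Import all_boot all_order all_algebra.
From mathcomp Require Import all_classical all_reals all_analysis.

Set Implicit Arguments.
Unset Strict Implicit.
Unset Printing Implicit Defensive.

Import Order.TTheory GRing.Theory Num.Theory.
Import numFieldNormedType.Exports.

Local Open Scope classical_set_scope.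
Local Open Scope ring_scope.

(* R^3 with the product sigma-algebra.  The library norm on products is the
   sup norm, so the Euclidean one is [norm3]. *)
Notation pt3 R := (R * R * R)%type.

Section Euclid.
Context {R : realType}.
Implicit Types u v : pt3 R.

Definition dot3 u v : R := u.1.1 * v.1.1 + u.1.2 * v.1.2 + u.2 * v.2.
Definition norm3 u : R := Num.sqrt (dot3 u u).

Definition sphere (rho : R) : set (pt3 R) := [set u | norm3 u = rho].

(* Surface area of A `&` sphere rho, in spherical coordinates. *)
Definition surface_area (rho : R) (A : set (pt3 R)) : \bar R :=
  (\int[lebesgue_measure]_(t in `[0%R, pi])
     \int[lebesgue_measure]_(p in `[0%R, (2 * pi)%R])
       (rho ^+ 2 * sin t *
        \1_A (rho * sin t * cos p, rho * sin t * sin p, rho * cos t)%R)%:E)%E.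
End Euclid.

Section SpecialFunctions.
Context {R : realType}.

Definition pochhammer (x : R) (n : nat) : R := \prod_(i < n) (x + i%:R).

(* 1F1(a; b; x) *)
Definition hyp1F1 (a b x : R) : R :=
  limn (series (fun n => pochhammer a n / pochhammer b n * x ^+ n / n`!%:R)).

Definition Gamma (a : R) : R :=
  \int[lebesgue_measure]_(t in `]0, +oo[) (t `^ (a - 1) * expR (- t)).

Definition log2 (x : R) : R := ln x / ln 2.
End SpecialFunctions.

Section Probability.
Context {d} {T : measurableType d} {R : realType} (P : probability T R).

Definition mutually_independent (I : eqType) (F : I -> set (set T)) : Prop :=
  forall (s : seq I) (E : I -> set T), uniq s ->
    (forall i, i \in s -> F i (E i)) ->
    P (\bigcap_(i in [set` s]) E i) = (\prod_(i <- s) P (E i))%E.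

(* A finite point process together with an enumeration of its points: the
   points are [pt X l w] for l < npts X w; other values of [pt] are
   irrelevant.  Nothing is lost for a Poisson process on a sphere, the
   intensity being finite. *)
Record point_process := PointProcess {
  npts : T -> nat ;
  pt : nat -> T -> pt3 R }.

Implicit Types (X : point_process) (A : set (pt3 R)).

Definition count X A (w : T) : nat :=
  (\sum_(l < npts X w) (pt X l w \in A))%N.

Definition count_events X A : set (set T) :=
  [set E | exists k : nat, E = [set w | count X A w = k]].

(* sigma-algebra of the (unlabelled) random point set *)
Definition sigma_counts X : set (set T) :=
  <<s [set E | exists2 A, measurable A & count_events X A E] >>.

(* The library's poisson_pmf is not the Dirac mass at 0 for rate 0, and sets
   of null area have to be allowed, hence the explicit formula. *)
Definition homogeneous_PPP (rho lam : R) X : Prop :=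
  [/\ measurable_fun setT (npts X) /\ (forall l, measurable_fun setT (pt X l)),
      forall w l, (l < npts X w)%N -> sphere rho (pt X l w),
      forall A, measurable A -> forall k : nat,
        let mu := lam * fine (surface_area rho A) in
        P [set w | count X A w = k] = (mu ^+ k / k`!%:R * expR (- mu))%:E
    & forall (n : nat) (A : 'I_n -> set (pt3 R)),
        (forall i, measurable (A i)) -> trivIset setT A ->
        mutually_independent (fun i => count_events X (A i))].

(* f is the density of D under P( . | V) *)
Definition is_cond_density (V : set T) (D : T -> R) (f : R -> R) : Prop :=
  [/\ measurable_fun setT f, forall r, 0 <= f r &
      forall A : set R, measurable A ->
        P (V `&` D @^-1` A)
          = (P V * \int[lebesgue_measure]_(r in A) (f r)%:E)%E].

(* kappa is a regular version of the conditional distribution of Y given D,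
   under P( . | V) *)
Definition is_cond_law (V : set T) (D Y : T -> R)
    (kappa : R.-pker R ~> R) : Prop :=
  forall A B : set R, measurable A -> measurable B ->
    (\int[P]_(w in V `&` D @^-1` A) kappa (D w) B)%E
      = P (V `&` D @^-1` A `&` Y @^-1` B).

(* L r s = E[e^{-sY} | D = r, V] for s > 0.  A regular version is taken, since
   L r is differentiated in s: choosing a version separately for each s would
   not determine these derivatives for any r. *)
Definition is_cond_laplace (V : set T) (D Y : T -> R) (L : R -> R -> R) : Prop :=
  exists2 kappa : R.-pker R ~> R, is_cond_law V D Y kappa &
    forall r s : R, 0 < s -> L r s = \int[kappa r]_x expR (- (s * x)).

End Probability.
Arguments point_process {d} T R.

(* satellite users, base stations, terrestrial users *)
Inductive node := Us | Bs | Ut.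

Definition node_eqb (o o' : node) : bool :=
  match o, o' with Us, Us | Bs, Bs | Ut, Ut => true | _, _ => false end.
Lemma node_eqP : Equality.axiom node_eqb.
Proof. by case; case; constructor. Qed.
HB.instance Definition _ := hasDecEq.Build node node_eqP.

Inductive mode := Dn | Up.

(* the terrestrial transmitters in each mode *)
Definition terrestrial (o : mode) : node :=
  match o with Dn => Bs | Up => Ut end.

Record params (R : realType) := Params {
  Rs : R ;              (* radius of the satellite sphere *)
  Rad : node -> R ;     (* radii of the other spheres *)
  lam : node -> R ;     (* densities per unit area *)
  theta : R ;           (* visible angle *)
  fc : R ; c0 : R ;     (* carrier frequency, speed of light *)
  Gs_main : R ; Gs_side : R ;
  Gus_main : R ; Gus_side : R ;
  GbH_side : R ; GbL_side : R ;
  Gut_side : R ;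
  psi1 : R ; psi2 : R ; (* elevation thresholds at the base stations *)
  sr_b : R ; sr_Omega : R ; ms : nat ; (* Shadowed-Rician parameters *)
  Ptx : node -> R ;     (* transmit powers *)
  sigma2 : R ;          (* noise power *)
  alpha : R             (* path-loss exponent *)
}.

Section System.
Context {R : realType} (S : params R).
Implicit Types (o : node) (u : pt3 R) (r : R).

Definition valid_params : Prop :=
  [/\ [/\ 0 < Rs S,
          forall o, 0 < Rad S o /\ Rad S o < Rs S,
          forall o, 0 < lam S o,
          0 < theta S /\ theta S < pi / 2 &
          forall o, Rs S * sin (theta S) <= Rad S o],
      0 < fc S /\ 0 < c0 S,
      [/\ 0 < Gs_main S /\ 0 < Gs_side S, 0 < Gus_main S /\ 0 < Gus_side S,
          0 < GbH_side S /\ 0 < GbL_side S, 0 < Gut_side S &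
          psi1 S < acos (Rs S / Rad S Bs * sin (theta S))],
      [/\ 0 < sr_b S, 0 < sr_Omega S & (0 < ms S)%N] &
      [/\ forall o, 0 < Ptx S o, 0 < sigma2 S & 0 < alpha S]].

Definition x1 : pt3 R := (0, 0, Rs S).
Definition dist u : R := norm3 (u - x1).

Definition Rmin o : R := Rs S - Rad S o.
Definition Rmax o : R :=
  Rs S * cos (theta S)
  - Num.sqrt (Rad S o ^+ 2 - Rs S ^+ 2 * sin (theta S) ^+ 2).
Definition lamt o : R := lam S o * (Rad S o / Rs S).

Definition cap_upto o r : set (pt3 R) :=
  sphere (Rad S o) `&` [set u | dist u <= r].
Definition cap o : set (pt3 R) := cap_upto o (Rmax o).

(* Angle of x1 - u above the plane tangent at u to the sphere through u. *)
Definition elevation u : R :=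
  asin (dot3 (x1 - u) u / (norm3 (x1 - u) * norm3 u)).

(* The last branch is never reached at a visible base station. *)
Definition Gb_side u : R :=
  if (psi1 S < elevation u) && (elevation u <= psi2 S) then GbH_side S
  else if psi2 S < elevation u then GbL_side S else 0.

Definition free_space : R := (c0 S / (4 * pi * fc S)) ^+ 2.
Definition G1 : R := Gs_main S * Gus_main S * free_space.

Definition side_gain o u : R :=
  Gs_side S *
  match o with Us => Gus_side S | Bs => Gb_side u | Ut => Gut_side S end *
  free_space.

Definition sr_const : R :=
  (2 * sr_b S * (ms S)%:R / (2 * sr_b S * (ms S)%:R + sr_Omega S)) ^+ ms S.
Definition beta : R := 1 / (2 * sr_b S).
Definition sr_c : R :=
  sr_Omega S / (2 * sr_b S * (2 * sr_b S * (ms S)%:R + sr_Omega S)).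
Definition zeta (z : nat) : R :=
  sr_const * (beta * (-1) ^+ z * pochhammer (1 - (ms S)%:R) z * sr_c ^+ z
              / z`!%:R ^+ 2).

Definition shadowed_rician_pdf (x : R) : R :=
  sr_const * (x / sr_b S) * expR (- (x ^+ 2 / (2 * sr_b S)))
  * hyp1F1 (ms S)%:R 1
      (sr_Omega S * x ^+ 2
       / (2 * sr_b S * (2 * sr_b S * (ms S)%:R + sr_Omega S))).

Section Network.
Context {d} {T : measurableType d} (P : probability T R).
Variables (Phi : node -> point_process T R) (H : node -> nat -> T -> R).

Definition shadowed_rician_power (h : T -> R) : Prop :=
  [/\ measurable_fun setT h, forall w, 0 <= h w &
      forall A : set R, measurable A ->
        P [set w | A (Num.sqrt (h w))]
          = (\int[lebesgue_measure]_(x in A `&` `]0%R, +oo[)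
               (shadowed_rician_pdf x)%:E)%E].

(* sigma-algebra of all the labelled points *)
Definition sigma_points : set (set T) :=
  <<s [set E | exists (o : node) (l : nat) (A : set (pt3 R)), measurable A /\
         E = [set w | (l < npts (Phi o) w)%N /\ A (pt (Phi o) l w)]] >>.

Definition fading_and_points (i : option (node * nat)) : set (set T) :=
  match i with
  | None => sigma_points
  | Some (o, l) => preimage_set_system setT (H o l) measurable
  end.

(* H o l is the fading of the l-th point of Phi o; the labels are those of the
   enumeration, which the fading does not depend on. *)
Definition network : Prop :=
  [/\ forall o, homogeneous_PPP P (Rad S o) (lam S o) (Phi o),
      mutually_independent P (fun o => sigma_counts (Phi o)),
      forall o l, shadowed_rician_power (H o l) &
      mutually_independent P fading_and_points].

Definition visible o (l : nat) (w : T) : bool := pt (Phi o) l w \in cap o.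

Definition user_visible : set T :=
  [set w | (1 <= count (Phi Us) (cap Us) w)%N].

(* label of the visible satellite user nearest to x1 (0 if there is none) *)
Definition served (w : T) : nat :=
  if [pick l : 'I_(npts (Phi Us) w) | visible Us l w] is Some l0
  then [arg min_(l < l0 | visible Us l w) dist (pt (Phi Us) l w)]%O
  else 0%N.

Definition serving_dist (w : T) : R := dist (pt (Phi Us) (served w) w).

(* power received at x1 through a side lobe *)
Definition side_power o (l : nat) (w : T) : R :=
  side_gain o (pt (Phi o) l w) * Ptx S o * H o l w
  * dist (pt (Phi o) l w) `^ (- alpha S).

Definition I_s (w : T) : R :=
  \sum_(l < npts (Phi Us) w | visible Us l w && (val l != served w))
     side_power Us l w.

Definition I_t (o : mode) (w : T) : R :=
  \sum_(l < npts (Phi (terrestrial o)) w | visible (terrestrial o) l w)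
     side_power (terrestrial o) l w.

Definition SINR (o : mode) (w : T) : R :=
  if w \in user_visible then
    G1 * Ptx S Us * H Us (served w) w * serving_dist w `^ (- alpha S)
    / (I_s w + I_t o w + sigma2 S)
  else 0.

Definition I_up (o : mode) r (w : T) : R :=
  \sum_(l < npts (Phi Us) w | pt (Phi Us) l w \in cap Us `\` cap_upto Us r)
     side_power Us l w
  + I_t o w + sigma2 S.

Definition spectral_efficiency (o : mode) : \bar R :=
  'E_P[fun w => log2 (1 + SINR o w)].

Definition is_nearest_density (f : R -> R) : Prop :=
  is_cond_density P user_visible serving_dist f.

(* Conditionally on the serving distance being r, I_up o r is
   I_up o (serving_dist w) w. *)
Definition is_interference_laplace (o : mode) (L : R -> R -> R) : Prop :=
  is_cond_laplace P user_visible serving_dist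
    (fun w => I_up o (serving_dist w) w) L.

End Network.
End System.

(* Main.v *)
Require Import Defs.
From HB Require Import structures.
From mathcomp Require Import all_boot all_order all_algebra.
From mathcomp Require Import all_classical all_reals all_analysis.
From mathcomp Require Import measurable_realfun.
From mathcomp Require Import ring lra.

Set Implicit Arguments.
Unset Strict Implicit.
Unset Printing Implicit Defensive.

Import Order.TTheory GRing.Theory Num.Theory.
Import numFieldNormedType.Exports.

Local Open Scope classical_set_scope.
Local Open Scope ring_scope.

(* With X the SINR, E[log2 (1 + X)] is the integral over g > 0 of
   P(X > g) * log2 e / (1 + g).  On the event that the served user has a given
   label, X > g means that its fading power exceeds g r^alpha I / (G1 P), with r
   the serving distance and I the interference plus noise; that fading power is
   independent of (r, I), so P(X > g) is the expectation of its complementary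
   distribution function at this threshold.  Kummer's transformation makes the
   latter a finite combination of t^v e^{-(beta - c) t}, and the conditional
   expectation of I^v e^{-sI} given r is (-1)^v times the v-th derivative of the
   conditional Laplace transform.  Two points are almost surely not equidistant
   from the satellite, hence I is I_up at the serving distance. *)

(** * Disintegration of integrals *)

(** The density [f] and the kernel [kappa] are arbitrary versions, known only through their
    integrals. At a single r nothing can be asserted: [kappa r] may charge the negative half-line on
    a null set or where [f] vanishes, and there neither the closed form of the fading tail, valid
    for nonnegative thresholds only, nor the formula for the Laplace derivatives is available. Hence
    the two integrands in r are matched off a null set only, and the integrals are compared without
    knowing that the one containing the derivatives of [L r] is measurable in r. Up to that point
    every integrand is nonnegative, so Tonelli and monotone convergence suffice. Signed terms appear
    only under [kappa r], where x^v exp(-s x) is bounded on x >= 0 for s > 0: no moment of the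
    interference is required. The served label is a function of the random points, so independence
    does not apply directly to its fading. Once the label is fixed to k, the interference omits the
    fading of label k, and the serving distance and the interference are measurable for all the
    other data. *)

Section Mixture.
Local Open Scope ereal_scope.
Import HBNNSimple.
Context d1 d2 (W : measurableType d1) (X : measurableType d2) (R : realType).
Variables (nu : {measure set W -> \bar R}) (D : set W) (mD : measurable D).
Variables (k : W -> {measure set X -> \bar R}) (m : {measure set X -> \bar R}).
Hypothesis mk : forall U, measurable U -> measurable_fun [set: W] (k ^~ U).
Hypothesis mE : forall U, measurable U -> m U = \int[nu]_(w in D) k w U.

Let mkD U : measurable U -> measurable_fun D (k ^~ U).
Proof. by move=> mU; apply: measurable_funS (mk mU). Qed.

Let integral_mixture_nnsfun (f : {nnsfun X >-> R}) :
  \int[m]_x (f x)%:E = \int[nu]_(w in D) \int[k w]_x (f x)%:E.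
Proof.
have sE (l : {measure set X -> \bar R}) : \int[l]_x (f x)%:E =
    \sum_(x \in range f) x%:E * l (f @^-1` [set x]).
  by rewrite integral_nnsfun// patch_setT sintegralE.
under [RHS]eq_integral do rewrite sE.
have mkf x : measurable_fun D (fun w => k w (f @^-1` [set x])) by exact: mkD.
have xk_ge0 (l : {measure set X -> \bar R}) x : 0 <= x%:E * l (f @^-1` [set x]).
  exact: nnsfun_mulemu_ge0.
rewrite ge0_integral_fsum//; last by move=> x; exact: measurable_funeM.
rewrite sE; apply: eq_fsbigr => x /set_mem[t _ <-].
by rewrite mE// ge0_integralZl_EFin//; exact: fun_ge0.
Qed.

(** [mE] is the case of indicators; linearity gives simple functions, and monotone convergence along
    [nnsfun_approx] gives [f]. *)
Lemma integral_mixture (f : X -> \bar R) : (forall x, 0 <= f x) ->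
  measurable_fun [set: X] f ->
  \int[m]_x f x = \int[nu]_(w in D) \int[k w]_x f x.
Proof.
move=> f0 mf.
pose f_ := nnsfun_approx measurableT mf.
have limE (l : {measure set X -> \bar R}) :
    \int[l]_x f x = lim ((\int[l]_x (f_ n x)%:E) @[n --> \oo]).
  transitivity (\int[l]_z (lim ((f_ n z)%:E @[n --> \oo]))).
    by apply/eq_integral => z _; apply/esym/cvg_lim => //=;
      exact: cvg_nnsfun_approx.
  rewrite monotone_convergence//.
  - by move=> n; exact/measurable_EFinP.
  - by move=> n z _; rewrite lee_fin.
  - by move=> z _ a b ab; rewrite lee_fin; exact/lefP/nd_nnsfun_approx.
rewrite limE.
under [X in lim (X @ _)]eq_fun do rewrite integral_mixture_nnsfun.
under [RHS]eq_integral do rewrite limE.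
rewrite monotone_convergence//.
- move=> n; apply: (measurable_funS measurableT) => //.
  apply: measurable_fun_integral_kernel => //.
  + by move=> z; rewrite lee_fin.
  + exact/measurable_EFinP.
- by move=> n y _; apply: integral_ge0 => // z _; rewrite lee_fin.
- move=> y _ a b ab; apply: ge0_le_integral => //.
  + by move=> z _; rewrite lee_fin.
  + exact/measurable_EFinP.
  + exact/measurable_EFinP.
  + by move=> z _; rewrite lee_fin; exact/lefP/nd_nnsfun_approx.
Qed.
End Mixture.

(** Names the canonical measure structure of the pushforward, so that the result has the bundled
    type expected of a kernel value. *)
Definition image_measure d1 d2 (T1 : measurableType d1) (T2 : measurableType d2)
    (R : realType) (m : {measure set T1 -> \bar R}) (f : T1 -> T2)
    (mf : measurable_fun [set: T1] f) : {measure set T2 -> \bar R} :=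
  measure_function_pushforward__canonical__measure_function_Measure m mf.

Section Disintegration.
Local Open Scope ereal_scope.
Context d1 d2 d3 (T : measurableType d1) (W : measurableType d2)
  (X : measurableType d3) (R : realType).

Lemma measurable_dirac_comp (g : T -> X) (U : set X) :
  measurable_fun [set: T] g -> measurable U ->
  measurable_fun [set: T] (fun t => (\d_(g t) : {measure set X -> \bar R}) U).
Proof.
move=> mg mU; rewrite (_ : (fun _ => _) = EFin \o (\1_U \o g)); last first.
  by apply/funext => t /=; rewrite diracE indicE.
by apply/measurable_EFinP; apply: measurableT_comp => //.
Qed.

(** Both sides integrate [f] against the measure U |-> P(V and g in U), which is a mixture in two
    ways: of the Dirac masses at [g t] over [P], and of the [k w] over [nu]. *)
Lemma integral_disintegration (P : {measure set T -> \bar R}) (V : set T)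
    (g : T -> X) (nu : {measure set W -> \bar R}) (D : set W)
    (k : W -> {measure set X -> \bar R}) (f : X -> \bar R) :
  measurable V -> measurable_fun [set: T] g -> measurable D ->
  (forall U, measurable U -> measurable_fun [set: W] (k ^~ U)) ->
  (forall U, measurable U ->
    P (V `&` g @^-1` U) = \int[nu]_(w in D) k w U) ->
  (forall x, 0 <= f x) -> measurable_fun [set: X] f ->
  \int[P]_(t in V) f (g t) = \int[nu]_(w in D) \int[k w]_x f x.
Proof.
move=> mV mg mD mk PE f0 mf.
have [m mE] : exists m : {measure set X -> \bar R},
    forall U, m U = P (V `&` g @^-1` U).
  exists (image_measure
    (mrestr P mV) mg) => U.
  by rewrite /= /pushforward /mrestr setIC.
rewrite -(integral_mixture mD (m := m) mk)//; last first.
  by move=> U mU; rewrite mE PE.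
rewrite (integral_mixture mV (m := m) (nu := P)
  (k := fun t => \d_(g t) : {measure set X -> \bar R}))//.
- by apply: eq_integral => t _; rewrite integral_dirac// diracT mul1e.
- by move=> U mU; exact: measurable_dirac_comp.
- move=> U mU; rewrite mE.
  rewrite (eq_integral (fun t => (\1_(g @^-1` U) t)%:E)).
    by rewrite integral_indic 1?setIC// -[X in measurable X]setTI; exact: mg.
  by move=> t _; rewrite /= diracE indicE.
Qed.
End Disintegration.

Section CondLaw.
Local Open Scope ereal_scope.
Context d (T : measurableType d) (R : realType) (P : probability T R).
Variables (V : set T) (D : T -> R).
Hypotheses (mV : measurable V) (mD : measurable_fun [set: T] D).

(** The law of [D] on [V] is the mixture of the masses [f r] at r over Lebesgue measure scaled by
    P(V). *)
Lemma integral_cond_density (f : R -> R) (g : R -> \bar R) :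
  is_cond_density P V D f ->
  (forall r, 0 <= g r) -> measurable_fun [set: R] g ->
  \int[P]_(w in V) g (D w) =
  P V * \int[lebesgue_measure]_r (g r * (f r)%:E).
Proof.
move=> [mf f0 fE] g0 mg.
pose fn r : {nonneg R} := NngNum (f0 r).
pose kk (r : measurableTypeR R) : {measure set (measurableTypeR R) -> \bar R} :=
  mscale (fn r) \d_r.
have mk (U : set (measurableTypeR R)) : measurable U ->
    measurable_fun [set: measurableTypeR R] (fun r => kk r U).
  move=> mU; rewrite /kk /= /mscale; apply: emeasurable_funM.
    exact/measurable_EFinP.
  exact: (measurable_dirac_comp (g := id)).
have PVfin : P V \is a fin_num by exact: fin_num_measure.
pose pv : {nonneg R} := NngNum (fine_ge0 (measure_ge0 P V)).
transitivity (\int[mscale pv lebesgue_measure]_(r in [set: measurableTypeR R])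
   \int[kk r]_x g x).
  apply: (integral_disintegration (g := D : T -> measurableTypeR R)) => //.
  move=> U mU; rewrite [LHS]fE//.
  rewrite ge0_integral_mscale//.
    rewrite fineK//; congr (_ * _).
    rewrite [LHS]integral_mkcond; apply: eq_integral => r _.
    transitivity ((f r)%:E * (r \in U)%:R%:E); last by [].
    by rewrite patchE; case: ifPn => rU; rewrite ?mule1 ?mule0.
  exact: mk.
have E r : \int[kk r]_x g x = g r * (f r)%:E.
  rewrite ge0_integral_mscale// integral_dirac// diracT mul1e.
  by rewrite muleC.
under eq_integral do rewrite E.
rewrite ge0_integral_mscale//; first by rewrite fineK.
- by apply: emeasurable_funM => //; exact/measurable_EFinP.
- by move=> r _; rewrite mule_ge0// lee_fin.
Qed.

(** The law of (D, Y) on [V] is the mixture over D of the kernel r |-> (Dirac mass at r) x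
    [kappa r]. On rectangles this is [is_cond_law]; Dynkin's theorem extends it to the product
    sigma-algebra. *)
Lemma integral_cond_law (Y : T -> R) (kappa : R.-pker R ~> R)
    (f : R * R -> \bar R) :
  measurable_fun [set: T] Y -> is_cond_law P V D Y kappa ->
  (forall r, 0 <= f r) -> measurable_fun [set: R * R] f ->
  \int[P]_(w in V) f (D w, Y w) =
  \int[P]_(w in V) \int[kappa (D w)]_y f (D w, y).
Proof.
move=> mY hk f0 mf.
have mpair (r : R) : measurable_fun [set: R] (fun y : R => (r, y)).
  exact: pair1_measurable.
pose k r : {measure set (R * R) -> \bar R} :=
  image_measure
    (kappa r) (mpair r).
have kE r U : k r U = kappa r (xsection U r).
  by rewrite /k/= /pushforward; congr (kappa r _); apply/seteqP; split => y;
    rewrite /xsection/= inE.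
have mk U : measurable U -> measurable_fun [set: R] (fun r => k r U).
  move=> mU; under eq_fun do rewrite kE.
  by apply: measurable_fun_xsection_finite_kernel; rewrite inE.
have mDY : measurable_fun [set: T] (fun w => (D w, Y w)).
  exact: measurable_fun_pair.
transitivity (\int[P]_(w in V) \int[k (D w)]_x f x); last first.
  apply: eq_integral => w _; rewrite /k/= ge0_integral_pushforward//.
have mkD U : measurable U -> measurable_fun [set: T] (fun w => k (D w) U).
  by move=> mU; apply: (measurableT_comp (mk U mU)).
apply: (integral_disintegration (g := fun w => (D w, Y w))) => //.
move=> U mU.
have k1 r : k r [set: R * R] = 1.
  rewrite kE (_ : xsection _ _ = setT) ?prob_kernel//.
  by apply/seteqP; split => y //; rewrite /xsection/= !inE.
pose Q U' := P (V `&` (fun w => (D w, Y w)) @^-1` U') = \int[P]_(w in V) k (D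
  w) U'.
apply: (@dynkin_induction _ (R * R)%type
  [set A `*` B | A in measurable & B in measurable] Q).
- by rewrite measurable_prod_measurableType.
- move=> _ _ [A1 mA1 [B1 mB1 <-]] [A2 mA2 [B2 mB2 <-]].
  by rewrite -setXI; exists (A1 `&` A2); [exact: measurableI|
    exists (B1 `&` B2) => //; exact: measurableI].
- rewrite /Q preimage_setT setIT.
  by rewrite (eq_integral (cst 1)) ?integral_cst ?mul1e// => w _; rewrite k1.
- move=> _ [A mA [B mB <-]]; rewrite /Q.
  rewrite (_ : V `&` _ = V `&` D @^-1` A `&` Y @^-1` B); last first.
    by apply/seteqP; split => w [] /=; [move=> Vw [] //|move=> [? ?] ?].
  rewrite -hk// integral_mkcondr; apply: eq_integral => w Vw.
  rewrite kE patchE; case: ifPn; rewrite ?inE/= => AD.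
    by rewrite in_xsectionX// inE.
  rewrite notin_xsectionX ?measure0//.
(* Complements: on both sides the masses of [S] and of its complement add up to P(V), and the finite
   mass of [S] cancels. *)
- move=> S mS QS.
  have mgS A : measurable A -> measurable ((fun w => (D w, Y w)) @^-1` A).
    by move=> mA; rewrite -[X in measurable X]setTI; exact: mDY.
  have PVE : P (V `&` (fun w => (D w, Y w)) @^-1` S) +
      P (V `&` (fun w => (D w, Y w)) @^-1` (~` S)) = P V.
    rewrite preimage_setC -setDE -measureU//; first last.
    - by rewrite setDE setIACA setICr setI0.
    - by apply: measurableD => //; exact: mgS.
    - by apply: measurableI => //; exact: mgS.
    by rewrite setDE -setIUr setUv setIT.
  have IE : \int[P]_(w in V) k (D w) S + \int[P]_(w in V) k (D w) (~` S) = P V.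
    rewrite -ge0_integralD//; first last.
    - by apply: (measurable_funS measurableT) => //; apply: mkD; exact:
      measurableC.
    - by apply: (measurable_funS measurableT) => //; exact: mkD.
    rewrite (eq_integral (cst 1)) ?integral_cst ?mul1e// => w _.
    by rewrite -(k1 (D w)) -measureU ?setUv ?setICr//; exact: measurableC.
  have Sfin : P (V `&` (fun w => (D w, Y w)) @^-1` S) \is a fin_num.
    by apply: fin_num_measure; apply: measurableI => //; exact: mgS.
  rewrite /Q -(addeK (P (V `&` _ @^-1` (~` S))) Sfin).
  rewrite -(addeK (\int[P]_(w in V) k (D w) (~` S)) Sfin).
  by rewrite [X in X - _ = _]addeC PVE [X in _ = X - _]addeC {2}QS IE.
- move=> F mF tF QF.
  have mgS A : measurable A -> measurable ((fun w => (D w, Y w)) @^-1` A).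
    by move=> mA; rewrite -[X in measurable X]setTI; exact: mDY.
  rewrite /Q preimage_bigcup setI_bigcupr measure_bigcup//; first last.
  - apply/trivIsetP => i j _ _ ij; rewrite setIACA setIid -preimage_setI.
    by move/trivIsetP : tF => /(_ _ _ _ _ ij) ->//; rewrite preimage_set0 setI0.
  - by move=> i _; apply: measurableI => //; exact: mgS.
  transitivity (\int[P]_(w in V) \sum_(n <oo) k (D w) (F n)).
    rewrite integral_nneseries//; last first.
      by move=> n; apply: (measurable_funS measurableT) => //; exact: mkD.
    transitivity (\sum_(n <oo) P (V `&` (fun w => (D w, Y w)) @^-1` F n)).
      by apply: eq_eseriesl => n; rewrite in_setT.
    by apply: eq_eseriesr => n _; exact: QF.
  apply: eq_integral => w _; rewrite measure_bigcup//.
  by apply: eq_eseriesl => n; rewrite in_setT.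
- by rewrite -measurable_prod_measurableType.
Qed.
End CondLaw.

(** * Independence *)

Section Independence.
Local Open Scope ereal_scope.
Context d (T : measurableType d) (R : realType) (P : probability T R).

(** Independence says that the constant kernel equal to the law of [h] is a conditional law of [h]
    given [Y] on [E]; the indicator of u.1 < u.2 is then integrated. *)
Lemma indep_tail (E : set T) (Y h : T -> R) :
  measurable E -> measurable_fun [set: T] Y -> measurable_fun [set: T] h ->
  (forall A B : set R, measurable A -> measurable B ->
    P (E `&` Y @^-1` A `&` h @^-1` B) = P (E `&` Y @^-1` A) * P (h @^-1` B)) ->
  P (E `&` [set w | Y w < h w]%R) =
  \int[P]_(w in E) P [set w' | Y w < h w']%R.
Proof.
move=> mE mY mh hind.
pose X : {mfun T >-> R} := HB.pack h (isMeasurableFun.Build _ _ _ _ h mh).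
pose kappa : R.-pker R ~> R := kprobability (measurable_cst (distribution P X :
  pprobability R R)).
have hk : is_cond_law P E Y h kappa.
  move=> A B mA mB; rewrite hind//.
  rewrite (eq_integral (cst (P (h @^-1` B))))// integral_cst//=; first exact:
    muleC.
  apply: measurableI => //; rewrite -[X in measurable X]setTI; exact: mY.
have mlt : measurable [set u : R * R | u.1 < u.2]%R.
  rewrite (_ : [set _ | _] = setT `&` (fun u : R * R => u.1 < u.2)%R @^-1` [set
    true]).
    by apply: measurable_fun_ltr.
  by rewrite setTI; apply/seteqP; split => u.
have mltw : measurable [set w | Y w < h w]%R.
  rewrite (_ : [set _ | _] = setT `&` (fun w : T => Y w < h w)%R @^-1` [set
    true]).
    exact: measurable_fun_ltr.
  by rewrite setTI; apply/seteqP; split => u.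
have := integral_cond_law mE mY mh hk (f := fun u => (\1_[set u : R * R | u.1 <
  u.2]%R u)%:E).
move=> /(_ _ _)/=; rewrite (_ : \int[P]_(w in E) _ = P (E `&` [set w | Y w < h
  w]%R)).
  move=> ->//; last by apply/measurable_EFinP.
  apply: eq_integral => w _.
  rewrite (_ : (fun y : R => _) = (fun y => (\1_(`]Y w, +oo[%classic : set R)
    y)%:E)); last first.
    apply/funext => y; rewrite !indicE; congr ((nat_of_bool _)%:R%:E).
    by apply/idP/idP; rewrite !inE/= in_itv/= andbT.
  rewrite integral_indic// setIT /kappa/= /kprobability /distribution
    /pushforward/=.
  by congr (P _); apply/seteqP; split => w' /=; rewrite in_itv/= andbT.
rewrite (eq_integral (fun w => (\1_[set w | Y w < h w]%R w)%:E)).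
  by rewrite integral_indic// setIC.
by move=> w _; rewrite !indicE; congr ((nat_of_bool _)%:R%:E); apply/idP/idP;
  rewrite !inE.
Qed.

(** Finite intersections of events with indices other than [i0] form a pi-system generating the
    sigma-algebra. On it the product formula is mutual independence with [i0] added to the indices,
    and the events satisfying the formula form a lambda-system. *)
Lemma mutually_independent_compl (I : eqType) (F : I -> set (set T)) (i0 : I) :
  (forall i, F i `<=` measurable) -> (forall i, setI_closed (F i)) ->
  (forall i, F i setT) ->
  mutually_independent P F ->
  forall A B, <<s \bigcup_(i in [set i | i != i0]) F i >> A -> F i0 B ->
  P (A `&` B) = P A * P B.
Proof.
move=> mF FI FT hF A B sA FB.
pose G := [set A | exists s E, [/\ uniq s, i0 \notin s,
  forall i, i \in s -> F i (E i) & A = \bigcap_(i in [set` s]) (E i : set T)]].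
have mB : measurable B by exact: mF FB.
pose H := [set A | measurable A /\ P (A `&` B) = P A * P B].
have GH : G `<=` H.
  move=> _ [s [E [us si0 FE ->]]].
  have mE : measurable (\bigcap_(i in [set` s]) E i).
    apply: fin_bigcap_measurable => // i si; exact: (mF i (E i) (FE _ si)).
  split => //.
  pose E' i := if i == i0 then B else E i.
  have E's i : i \in s -> E' i = E i.
    by move=> si; rewrite /E'; case: eqP si0 si => // -> /negbTE ->.
  have E'0 : E' i0 = B by rewrite /E' eqxx.
  have := hF (i0 :: s) E'; rewrite /= si0 us => /(_ isT).
  rewrite big_cons E'0 (_ : \bigcap_(i in _) E' i = (\bigcap_(i in [set` s]) E
    i) `&` B).
    move=> -> //; last first.
      move=> i; rewrite inE => /orP[/eqP ->|si]; first by rewrite E'0.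
      by rewrite E's//; exact: FE.
    have -> : (\prod_(j <- s) P (E' j))%E = P (\bigcap_(i in [set` s]) E i).
      rewrite hF// big_seq [RHS]big_seq.
      by apply: eq_bigr => i si; rewrite E's.
    by rewrite muleC.
  apply/seteqP; split => [w Ew|w [Ew Bw] i /=].
    split; last by rewrite -E'0; apply: Ew; rewrite /= inE eqxx.
    by move=> i /= si; rewrite -E's//; apply: Ew; rewrite /= inE si orbT.
  by rewrite inE => /orP[/eqP ->|si]; [rewrite E'0|rewrite E's//; exact: Ew].
have GI : setI_closed G.
  move=> _ _ [s1 [E1 [us1 s1i FE1 ->]]] [s2 [E2 [us2 s2i FE2 ->]]].
  (* The two index lists may overlap, hence [undup]; an index absent from one list contributes
     [setT] there. *)
  exists (undup (s1 ++ s2)), (fun i => (if i \in s1 then E1 i else setT) `&`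
    (if i \in s2 then E2 i else setT)); split.
  - exact: undup_uniq.
  - by rewrite mem_undup mem_cat negb_or s1i.
  - move=> i _; apply: FI; case: ifPn => // si; [exact: FE1|exact: FE2].
  - apply/seteqP; split => [w [E1w E2w] i /= _|w Ew].
      by split; case: ifPn => // si; [exact: E1w|exact: E2w].
    split => i /= si.
      by have [] := Ew i; rewrite /= ?mem_undup ?mem_cat si.
    by have [] := Ew i; rewrite /= ?mem_undup ?mem_cat si ?orbT//.
suff GsH : <<s G >> `<=` H.
  have [] : H A => //; apply: GsH; move: A sA.
  apply: smallest_sub; first exact: smallest_sigma_algebra.
  apply: subset_trans (@sub_sigma_algebra _ _ _).
  move=> C [i /= ii0 FC]; exists [:: i], (fun=> C); split => //.
  - by rewrite inE eq_sym.
  - by move=> j; rewrite inE => /eqP ->.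
  - by apply/seteqP; split => [w Cw j _//|w /(_ i)]; apply => /=; rewrite inE.
apply: lambda_system_subset => //.
apply/dynkin_lambda_system; split.
- by split => //; rewrite setTI probability_setT mul1e.
- move=> C [mC PC]; split; first exact: measurableC.
  have fB : P B \is a fin_num by exact: fin_num_measure.
  have fC : P C \is a fin_num by exact: fin_num_measure.
  rewrite setIC -setDE measureD//; last by rewrite ltey_eq fB.
  rewrite [X in P B - P X]setIC PC probability_setC// -(fineK fB) -(fineK fC)
    -[1]/(1%R%:E).
  by rewrite -EFinM -!EFinB -EFinM mulrBl mul1r.
- move=> C tC HC; have mC n : measurable (C n) by have [] := HC n.
  split; first exact: bigcupT_measurable.
  have fB : P B \is a fin_num by exact: fin_num_measure.
  rewrite setI_bigcupl !measure_bigcup//; first last.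
  - apply/trivIsetP => i j _ _ ij; rewrite setIACA setIid.
    by move/trivIsetP : tC => /(_ _ _ _ _ ij) ->//; rewrite set0I.
  - by move=> n _; apply: measurableI.
  rewrite -(fineK fB) muleC -nneseriesZl//.
  apply: eq_eseriesr => n _; rewrite fineK// muleC.
  by have [] := HC n.
Qed.
End Independence.

(** * Null sets *)

Section NullSets.
Local Open Scope ereal_scope.
Import HBNNSimple.
Context d (T : measurableType d) (R : realType) (mu : {measure set T -> \bar
  R}).
Variables (N : set T) (mN : measurable N) (N0 : mu N = 0).

(** The integral is a supremum over simple functions below the integrand. Multiplying such a
    function by the indicator of the complement of [N] keeps its integral and places it below [q];
    [p] and [q] need not be measurable. *)
Let ge0_integral_le_off_null (p q : T -> \bar R) :
  (forall x, 0 <= p x) -> (forall x, 0 <= q x) -> (forall x, ~ N x -> p x = q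
    x) ->
  \int[mu]_x p x <= \int[mu]_x q x.
Proof.
move=> p0 q0 pq; rewrite !ge0_integralTE//.
apply: ge_ereal_sup => _ [h /= hp <-].
have mNC : measurable (~` N) by exact: measurableC.
pose h' := mul_nnsfun h (indic_nnsfun R mNC).
have -> : sintegral mu h = sintegral mu h'.
  have sE (l : {nnsfun T >-> R}) : sintegral mu l = \int[mu]_x (l x)%:E.
    by rewrite integral_nnsfun// patch_setT.
  rewrite !sE; apply: ge0_ae_eq_integral => //.
  - exact/measurable_EFinP.
  - exact/measurable_EFinP.
  - by move=> x _; rewrite lee_fin.
  - by move=> x _; rewrite lee_fin.
  - exists N; split => // x /= /not_implyP[_]; apply: contra_notP => Nx.
    rewrite -[RHS]/((h x * \1_(~` N) x)%R%:E).
    by rewrite indicE mem_set// mulr1.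
apply: ereal_sup_ubound; exists h' => // x; rewrite -[h' x]/(h x * \1_(~` N)
  x)%R.
rewrite indicE; have [Nx|Nx] := boolP (x \in ~` N).
  by rewrite mulr1 -pq//; exact: set_mem.
by rewrite mulr0.
Qed.

(* Applied to integrands which are only known to be measurable off a null set,
   whence the recourse to the definition of the integral. *)
Lemma eq_integral_off_null (D : set T) (f g : T -> \bar R) :
  (forall x, D x -> ~ N x -> f x = g x) ->
  \int[mu]_(x in D) f x = \int[mu]_(x in D) g x.
Proof.
move=> fg.
have pn (p q : T -> \bar R) : (forall x, 0 <= p x) -> (forall x, 0 <= q x) ->
    (forall x, ~ N x -> p x = q x) -> \int[mu]_x p x = \int[mu]_x q x.
  move=> p0 q0 pq; apply/eqP; rewrite eq_le !ge0_integral_le_off_null// => x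
    /pq//.
have fgD x : ~ N x -> (f \_ D) x = (g \_ D) x.
  by move=> Nx; rewrite !patchE; case: ifPn => // /set_mem Dx; exact: fg.
rewrite integral_mkcond [RHS]integral_mkcond integralE [RHS]integralE.
by congr (_ - _); apply: pn => // x Nx; rewrite ?funeposE ?funenegE fgD.
Qed.

End NullSets.

(** * Measurability of the network quantities *)

Section MeasurableReal.
Context {R : realType}.

Lemma measurable_sqrt : measurable_fun [set: R] (@Num.sqrt R).
Proof. by apply: continuous_measurable_fun; exact: sqrt_continuous. Qed.

Lemma measurable_inv : measurable_fun [set: R] (@GRing.inv R).
Proof.
rewrite (_ : GRing.inv = fun x : R => if x == 0 then 0 else x^-1); last first.
  by apply/funext => x; case: eqP => // ->; rewrite invr0.
apply: measurable_fun_if => //.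
  by apply: measurable_fun_eqr.
rewrite setTI (_ : _ @^-1` _ = [set x | x != 0]); last first.
  by apply/seteqP; split => x /=; [move=> /negbT|move=> /negbTE].
apply: open_continuous_measurable_fun; first exact: open_neq.
by move=> x; rewrite inE /= => x0; exact: inv_continuous.
Qed.

(** Continuity is available on the open interval only; the endpoints are isolated, and beyond them
    no angle has the given sine, so [asin] is the constant default [point]. *)
Lemma measurable_asin : measurable_fun [set: R] (@asin R).
Proof.
rewrite (_ : @asin R = fun x : R => if (-1 < x) && (x < 1) then asin x else
  if x == 1 then asin 1 else if x == -1 then asin (-1) else point); last first.
  apply/funext => x; case: ifPn => // x1; case: eqVneq => [->//|xn1].
  case: eqVneq => [->//|xnN1].
  rewrite unlock xgetPN// => y [_ yx]; move: x1; rewrite -{1 2}yx => /negP;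
    apply.
  by rewrite !lt_neqAle sin_geN1 sin_le1 yx xn1 eq_sym xnN1.
have mB : measurable_fun [set: R] (fun x : R => (-1 < x) && (x < 1)).
  by apply: measurable_and; apply: measurable_fun_ltr.
apply: measurable_fun_if => //.
  rewrite setTI (_ : _ @^-1` _ = `]-1, 1[%classic); last first.
    by apply/seteqP; split => x /=; rewrite in_itv.
  apply: open_continuous_measurable_fun; first exact: itv_open.
  by move=> x; rewrite inE/= in_itv => /= /continuous_asin.
apply: (measurable_funS measurableT) => //.
apply: measurable_fun_ifT => //; first exact: measurable_fun_eqr.
by apply: measurable_fun_ifT => //; exact: measurable_fun_eqr.
Qed.

End MeasurableReal.

Section MeasurableCases.
Context d (T : measurableType d).

(** Handles every random index and every sum with a random number of terms, by splitting over the
    countably many values of [N]. *)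
Lemma measurable_fun_nat_case d' (U : measurableType d') (N : T -> nat)
    (h : nat -> T -> U) :
  measurable_fun [set: T] N -> (forall n, measurable_fun [set: T] (h n)) ->
  measurable_fun [set: T] (fun w => h (N w) w).
Proof.
move=> mN mh _ A mA; rewrite setTI.
rewrite (_ : _ @^-1` A = \bigcup_n (N @^-1` [set n] `&` h n @^-1` A)).
  apply: bigcupT_measurable => n; apply: measurableI.
    by rewrite -[X in measurable X]setTI; exact: mN.
  by rewrite -[X in measurable X]setTI; exact: mh.
apply/seteqP; split => [w Aw|w [n _ [/= <-]]//].
by exists (N w).
Qed.

(** A preimage is a finite union over the truth tables that [g] sends into the target set. *)
Lemma measurable_fun_ffun (I : finType) (p : I -> T -> bool)
    (g : {ffun I -> bool} -> nat) :
  (forall i, measurable_fun [set: T] (p i)) ->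
  measurable_fun [set: T] (fun w => g [ffun i => p i w]).
Proof.
move=> mp _ A mA; rewrite setTI.
rewrite (_ : _ @^-1` A = \bigcup_(c in [set c | A (g c)])
   \bigcap_(i in [set: I]) (p i @^-1` [set c i])).
  apply: fin_bigcup_measurable => [|c _]; first exact: finite_finset.
  apply: fin_bigcap_measurable => [|i _]; first exact: finite_finset.
  by rewrite -[X in measurable X]setTI; exact: mp.
apply/seteqP; split => [w /= Aw|w [c /= Ac cw]].
  by exists [ffun i => p i w] => //= i _; rewrite ffunE.
by rewrite (_ : [ffun i => p i w] = c)//; apply/ffunP => i; rewrite ffunE cw.
Qed.

Lemma measurable_fun_mem d' (U : measurableType d') (A : set U) (g : T -> U) :
  measurable A -> measurable_fun [set: T] g ->
  measurable_fun [set: T] (fun w => g w \in A).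
Proof.
move=> mA mg; apply: (@measurable_fun_bool _ _ _ _ true).
rewrite setTI (_ : _ @^-1` _ = g @^-1` A).
  by rewrite -[X in measurable X]setTI; exact: mg.
by apply/seteqP; split => w /=; [exact: set_mem|exact: mem_set].
Qed.

Lemma measurable_fun_natl d' (U : measurableType d') (g : nat -> U) (N : T ->
  nat) :
  measurable_fun [set: T] N -> measurable_fun [set: T] (g \o N).
Proof. by move=> mN; apply: measurableT_comp. Qed.

End MeasurableCases.

Section MeasurableGeometry.
Context {R : realType} (S : params R).

Let m3 d (T : measurableType d) (f : T -> pt3 R) : measurable_fun [set: T] f ->
  [/\ measurable_fun [set: T] (fun t => (f t).1.1),
      measurable_fun [set: T] (fun t => (f t).1.2) &
      measurable_fun [set: T] (fun t => (f t).2)].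
Proof.
move=> mf.
have mf1 : measurable_fun [set: T] (fun t => (f t).1).
  exact: (measurableT_comp measurable_fst mf).
split.
- exact: (measurableT_comp measurable_fst mf1).
- exact: (measurableT_comp measurable_snd mf1).
- exact: (measurableT_comp measurable_snd mf).
Qed.

Lemma measurable_dot3 d (T : measurableType d) (f g : T -> pt3 R) :
  measurable_fun [set: T] f -> measurable_fun [set: T] g ->
  measurable_fun [set: T] (fun t => dot3 (f t) (g t)).
Proof.
move=> /m3[f1 f2 f3] /m3[g1 g2 g3]; rewrite /dot3.
by apply: measurable_funD; [apply: measurable_funD|]; exact: measurable_funM.
Qed.

Lemma measurable_norm3 d (T : measurableType d) (f : T -> pt3 R) :
  measurable_fun [set: T] f -> measurable_fun [set: T] (fun t => norm3 (f t)).
Proof.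
move=> mf; rewrite /norm3; apply: (measurableT_comp measurable_sqrt).
exact: measurable_dot3.
Qed.

Let measurable_sub_x1 : measurable_fun [set: pt3 R] (fun u => u - x1 S).
Proof.
have [m1 m2 m'3] := m3 (@measurable_id _ (pt3 R) setT).
rewrite (_ : (fun _ => _) = fun u : pt3 R => (u.1.1 - 0, u.1.2 - 0, u.2 - Rs
  S)).
  by apply: measurable_fun_pair; [apply: measurable_fun_pair|];
    exact: measurable_funB.
by apply/funext => -[[a b] c].
Qed.

Let measurable_x1_sub : measurable_fun [set: pt3 R] (fun u => x1 S - u).
Proof.
have [m1 m2 m'3] := m3 (@measurable_id _ (pt3 R) setT).
rewrite (_ : (fun _ => _) = fun u : pt3 R => (0 - u.1.1, 0 - u.1.2, Rs S -
  u.2)).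
  by apply: measurable_fun_pair; [apply: measurable_fun_pair|];
    exact: measurable_funB.
by apply/funext => -[[a b] c].
Qed.

Lemma measurable_dist : measurable_fun [set: pt3 R] (dist S).
Proof. exact: measurable_norm3. Qed.

Lemma measurable_elevation : measurable_fun [set: pt3 R] (elevation S).
Proof.
rewrite /elevation; apply: (measurableT_comp measurable_asin).
apply: measurable_funM; first exact: measurable_dot3.
apply: (measurableT_comp measurable_inv).
by apply: measurable_funM; exact: measurable_norm3.
Qed.

Lemma measurable_sphere rho : measurable (sphere rho : set (pt3 R)).
Proof.
rewrite (_ : sphere rho = setT `&` (@norm3 R) @^-1` [set rho]).
  by apply: (measurable_norm3 (@measurable_id _ (pt3 R) setT)).
by rewrite setTI.
Qed.

Lemma measurable_cap_upto o r : measurable (cap_upto S o r).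
Proof.
apply: measurableI; first exact: measurable_sphere.
rewrite (_ : [set _ | _] = setT `&` dist S @^-1` `]-oo, r]).
  exact: measurable_dist.
by rewrite setTI; apply/seteqP; split => u /=; rewrite in_itv.
Qed.

Lemma measurable_side_gain o : measurable_fun [set: pt3 R] (side_gain S o).
Proof.
have me := measurable_elevation.
have m0 : measurable_fun [set: pt3 R] (Gb_side S).
  apply: measurable_fun_ifT => //.
    by apply: measurable_and; [apply: measurable_fun_ltr|apply:
      measurable_fun_ler].
  by apply: measurable_fun_ifT => //; exact: measurable_fun_ltr.
rewrite /side_gain; apply: measurable_funM => //; apply: measurable_funM => //.
by case: o.
Qed.

End MeasurableGeometry.

Lemma mem_cap_upto {R : realType} (S : params R) o r u :
  u \in cap S o -> (u \in cap_upto S o r) = (dist S u <= r).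
Proof.
move=> /set_mem[su _]; apply/idP/idP => [/set_mem[]//|ur].
exact: mem_set.
Qed.

Section MeasurableNetwork.
Context {R : realType} (S : params R) d (T : measurableType d).
Variables (Phi : node -> point_process T R) (H : node -> nat -> T -> R).
Hypothesis mN : forall o, measurable_fun [set: T] (npts (Phi o)).
Hypothesis mpt : forall o l, measurable_fun [set: T] (pt (Phi o) l).
Hypothesis mH : forall o l, measurable_fun [set: T] (H o l).

Lemma measurable_count o A :
  measurable A -> measurable_fun [set: T] (Defs.count (Phi o) A).
Proof.
move=> mA.
apply: (measurable_fun_nat_case (h := fun n w => (\sum_(l < n) (pt (Phi o) l w
  \in A))%N)) => // n.
pose g (c : {ffun 'I_n -> bool}) := (\sum_l c l)%N.
rewrite (_ : (fun w => _) = fun w => g [ffun l : 'I_n => pt (Phi o) l w \in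
  A]); last first.
  by apply/funext => w; apply: eq_bigr => l _; rewrite ffunE.
by apply: measurable_fun_ffun => l; exact: measurable_fun_mem.
Qed.

Lemma measurable_user_visible : measurable (user_visible S Phi).
Proof.
rewrite (_ : user_visible S Phi = [set: T] `&` Defs.count (Phi Us) (cap S Us)
  @^-1` [set n | (1 <= n)%N]).
  by apply: measurable_count => //; exact: measurable_cap_upto.
by rewrite setTI.
Qed.

Lemma measurable_visible o l : measurable_fun [set: T] (visible S Phi o l).
Proof. by apply: measurable_fun_mem => //; exact: measurable_cap_upto. Qed.

Lemma measurable_dist_pt o l :
  measurable_fun [set: T] (fun w => dist S (pt (Phi o) l w)).
Proof. exact: (measurableT_comp (measurable_dist S) (mpt o l)). Qed.

(** For a fixed number of points, the label depends only on finitely many truth values: which points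
    are visible, and how their distances compare pairwise. *)
Lemma measurable_served : measurable_fun [set: T] (served S Phi).
Proof.
pose h n w : nat :=
  if [pick l : 'I_n | visible S Phi Us l w] is Some l0
  then [arg min_(l < l0 | visible S Phi Us l w) dist S (pt (Phi Us) l w)]%O
  else 0%N.
apply: (measurable_fun_nat_case (h := h)) => // n.
pose I : finType := ('I_n + 'I_n * 'I_n)%type.
pose p (i : I) w : bool := match i with
  | inl l => visible S Phi Us l w
  | inr (l, l') => dist S (pt (Phi Us) l w) <= dist S (pt (Phi Us) l' w) end.
(* The definition of [arg min], a pick with default [l0], read off the truth table. *)
pose g (c : {ffun I -> bool}) : nat :=
  if [pick l : 'I_n | c (inl l)] is Some l0
  then odflt l0 [pick i : 'I_n | c (inl i) &&
    [forall (j : 'I_n | c (inl j)), c (inr (i, j))]] else 0%N.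
rewrite (_ : h n = fun w => g [ffun i => p i w]).
  apply: measurable_fun_ffun => -[l|[l l']] /=; first exact: measurable_visible.
  by apply: measurable_fun_ler; exact: measurable_dist_pt.
apply/funext => w; rewrite /h /g.
rewrite [in RHS](eq_pick (Q := fun l : 'I_n => visible S Phi Us l w)); last
  first.
  by move=> l; rewrite ffunE.
case: pickP => // l0 _; congr (nat_of_ord (odflt _ _)); apply: eq_pick => i /=.
rewrite ffunE; congr (_ && _); apply/forallP/forallP => /= Hj j; have := Hj j;
  rewrite !ffunE//.
Qed.

Lemma measurable_serving_dist : measurable_fun [set: T] (serving_dist S Phi).
Proof.
apply: (measurable_fun_nat_case (h := fun n w => dist S (pt (Phi Us) n w))).
  exact: measurable_served.
by move=> n; exact: measurable_dist_pt.
Qed.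

Lemma measurable_side_power o l : measurable_fun [set: T] (side_power S Phi H o
  l).
Proof.
rewrite /side_power; apply: measurable_funM; [apply: measurable_funM|] => //.
  apply: measurable_funM => //.
  exact: (measurableT_comp (measurable_side_gain S o) (mpt o l)).
exact: (measurableT_comp (@measurable_powR R (- alpha S)) (measurable_dist_pt o
  l)).
Qed.

Lemma measurable_fun_random_sum o (c : nat -> T -> bool) :
  (forall l, measurable_fun [set: T] (c l)) ->
  measurable_fun [set: T]
    (fun w => \sum_(l < npts (Phi o) w | c l w) side_power S Phi H o l w).
Proof.
move=> mc.
apply: (measurable_fun_nat_case
  (h := fun n w => \sum_(l < n | c l w) side_power S Phi H o l w)) => // n.
under eq_fun do rewrite big_mkcond/=.
apply: measurable_sum => l.
by apply: measurable_fun_ifT => //; exact: measurable_side_power.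
Qed.

Lemma measurable_I_s : measurable_fun [set: T] (I_s S Phi H).
Proof.
apply: (@measurable_fun_random_sum Us
  (fun l w => visible S Phi Us l w && (l != served S Phi w))) => l.
apply: measurable_and; first exact: measurable_visible.
apply: (measurable_fun_natl (fun n : nat => l != n)); exact: measurable_served.
Qed.

Lemma measurable_I_t o : measurable_fun [set: T] (I_t S Phi H o).
Proof.
apply: (@measurable_fun_random_sum (terrestrial o) (fun l w => visible S Phi
  (terrestrial o) l w)) => l.
exact: measurable_visible.
Qed.

Lemma measurable_I_up o :
  measurable_fun [set: T] (fun w => I_up S Phi H o (serving_dist S Phi w) w).
Proof.
rewrite /I_up; apply: measurable_funD => //; apply: measurable_funD.
  apply: (@measurable_fun_random_sum Us (fun l w => pt (Phi Us) l w
      \in cap S Us `\` cap_upto S Us (serving_dist S Phi w))) => l.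
  rewrite (_ : (fun w => _) = fun w => visible S Phi Us l w &&
      ~~ (visible S Phi Us l w && (dist S (pt (Phi Us) l w) <= serving_dist S
        Phi w))).
    apply: measurable_and; first exact: measurable_visible.
    apply: measurable_neg; apply: measurable_and; first exact:
      measurable_visible.
    by apply: measurable_fun_ler; [exact: measurable_dist_pt|exact:
      measurable_serving_dist].
  apply/funext => w; rewrite in_setD /visible.
  by case: (boolP (_ \in cap S Us)) => //= cu; rewrite mem_cap_upto.
exact: measurable_I_t.
Qed.

Lemma measurable_SINR o : measurable_fun [set: T] (SINR S Phi H o).
Proof.
rewrite /SINR; apply: measurable_fun_ifT => //.
  by apply: measurable_fun_mem => //; exact: measurable_user_visible.
apply: measurable_funM; last first.
  apply: (measurableT_comp measurable_inv); apply: measurable_funD => //.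
  by apply: measurable_funD; [exact: measurable_I_s|exact: measurable_I_t].
apply: measurable_funM; last first.
  exact: (measurableT_comp (@measurable_powR R (- alpha S))
    measurable_serving_dist).
apply: measurable_funM => //.
apply: (measurable_fun_nat_case (h := fun n w => H Us n w)) => //.
exact: measurable_served.
Qed.

End MeasurableNetwork.

(** * Layer cake *)

Section LayerCake.
Context {R : realType}.

Lemma log2_expR1 : log2 (expR 1) = (ln 2)^-1 :> R.
Proof. by rewrite /log2 expRK mul1r. Qed.

Lemma integral_inv1D (x : R) : 0 <= x ->
  (\int[lebesgue_measure]_(t in `]0%R, x[) ((1 + t)^-1)%:E = (ln (1 + x))%:E)%E.
Proof.
move=> x0.
have dF (t : R) : 0 <= t -> is_derive t 1 (fun t : R => ln (1 + t)) (1 + t)^-1.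
  move=> t0; have t1 : 0 < 1 + t by rewrite ltr_pwDl.
  have d1 : is_derive t 1 (fun t : R => 1 + t) 1.
    by apply: is_derive_eq; rewrite add0r mulr1.
  have := @is_derive1_comp R (@ln R) (fun t : R => 1 + t) t _ _ (is_derive1_ln
    t1) d1.
  by move=> h; apply: is_derive_eq; rewrite ?mul1r ?mulr1.
have minv : measurable_fun [set: R] (fun t : R => (1 + t)^-1).
  by apply: (measurableT_comp measurable_inv); exact: measurable_funD.
rewrite integral_itv_bndo_bndc; last first.
  by apply/measurable_EFinP; exact: measurable_funTS.
rewrite integral_itv_obnd_cbnd; last first.
  by apply/measurable_EFinP; exact: measurable_funTS.
move: x0; rewrite le_eqVlt => /orP[/eqP <-|x0].
  by rewrite set_itv1 integral_set1 addr0 ln1.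
have cF (t : R) : 0 <= t -> (fun t : R => ln (1 + t)) @ t --> ln (1 + t).
  move=> t0; have /derivable1_diffP/differentiable_continuous :
      derivable (fun t : R => ln (1 + t)) t 1 by have [] := dF _ t0.
  exact.
rewrite (@continuous_FTC2 R _ (fun t => ln (1 + t)))//.
- by rewrite addr0 ln1 sube0.
- apply: continuous_in_subspaceT => t; rewrite inE/= in_itv/= => /andP[t0 _].
  apply: (@continuousV R R (fun t : R => 1 + t)); first by rewrite gt_eqF//
    ltr_pwDl.
  by apply: cvgD; [exact: cvg_cst|exact: cvg_id].
- split.
  + by move=> t; rewrite in_itv/= => /andP[/ltW t0 _]; have [] := dF _ t0.
  + by apply: cvg_at_right_filter; apply: cF.
  + by apply: cvg_at_left_filter; apply: cF; rewrite ltW.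
- by move=> t; rewrite in_itv/= => /andP[/ltW t0 _]; rewrite derive1E; have [_
  ->] := dF _ t0.
Qed.

Lemma expectation_log2 d (T : measurableType d) (P : probability T R) (X : T ->
  R) :
  measurable_fun [set: T] X -> (forall w, 0 <= X w) ->
  ('E_P[fun w => log2 (1 + X w)] =
  \int[lebesgue_measure]_(g in `]0%R, +oo[)
    ((log2 (expR 1) / (1 + g))%:E * P [set w | g < X w]%R))%E.
Proof.
move=> mX X0; rewrite log2_expR1.
have ln2 : 0 < ln 2 :> R by rewrite ln_gt0// ltr1n.
pose c : R := (ln 2)^-1.
have c0 : 0 <= c by rewrite invr_ge0 ltW.
(* The absolute value makes [k] nonnegative everywhere at once; for 0 < g it changes nothing. *)
pose k (u : T * measurableTypeR R) : R :=
  \1_[set u : T * measurableTypeR R | (0 < u.2) && (u.2 < X u.1)] u * `|c / (1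
    + u.2)|.
have mk : measurable_fun [set: T * measurableTypeR R] k.
  apply: measurable_funM.
    apply: measurable_indic.
    rewrite (_ : [set u | _] = setT `&` (fun u : T * measurableTypeR R => (0 <
      u.2) && (u.2 < X u.1)) @^-1` [set true]).
      apply: measurable_and => //; apply: measurable_fun_ltr => //.
      exact: (measurableT_comp mX measurable_fst).
    by rewrite setTI; apply/seteqP; split => u.
  apply: (measurableT_comp (@normr_measurable R setT)).
  apply: measurable_funM => //; apply: (measurableT_comp measurable_inv).
  exact: measurable_funD.
have k0 u : (0 <= (k u)%:E)%E by rewrite lee_fin mulr_ge0.
rewrite unlock.
transitivity (\int[P]_w \int[lebesgue_measure]_g (k (w, g))%:E)%E.
  apply: eq_integral => w _.
  rewrite (_ : (fun g => _) = fun g => ((fun g => c%:E * ((1 + g)^-1)%:E) \_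
    `]0%R, X w[) g)%E; last first.
    apply/funext => g; rewrite patchE /k indicE; case: ifPn => gX.
      move/set_mem: gX; rewrite /= in_itv/= => gX.
      rewrite mem_set// mul1r -EFinM ger0_norm// divr_ge0//.
      by move: gX => /andP[/ltW g0 _]; rewrite addr_ge0.
    rewrite memNset ?mul0r//= => gX'; move/negP: gX; apply.
    by apply/mem_set; rewrite /= in_itv.
  rewrite -integral_mkcond ge0_integralZl//.
  - rewrite integral_inv1D// -EFinM /log2 /c mulrC//.
  - by apply/measurable_EFinP; apply: (measurable_funS measurableT) => //;
      apply: (measurableT_comp measurable_inv); exact: measurable_funD.
  - by move=> g /=; rewrite in_itv/= => /andP[/ltW g0 _]; rewrite lee_fin
    invr_ge0 addr_ge0.
rewrite (fubini_tonelli (m1 := P) (m2 := lebesgue_measure) (EFin \o k))//=;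
  last first.
  exact/measurable_EFinP.
rewrite [RHS]integral_mkcond; apply: eq_integral => g _.
rewrite patchE; case: ifPn => g0; last first.
  rewrite integral0_eq// => w _; rewrite /k indicE memNset ?mul0r//= =>
    /andP[g0' _].
  by move/negP: g0; apply; apply/mem_set; rewrite /= in_itv/= g0'.
move/set_mem: g0; rewrite /= in_itv/= andbT => g0.
rewrite (eq_integral (fun w => (c / (1 + g))%:E * (\1_[set w | g < X w]
  w)%:E)%E); last first.
  move=> w _; rewrite /k -EFinM mulrC ger0_norm; last by rewrite divr_ge0//
    addr_ge0// ltW.
  by congr (_ * _)%:E; rewrite !indicE; congr (nat_of_bool _)%:R;
    apply/idP/idP; rewrite !inE/= g0.
have mlt : measurable [set w | g < X w].
  rewrite (_ : [set w | _] = setT `&` X @^-1` `]g, +oo[); first exact: mX.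
  by rewrite setTI; apply/seteqP; split => w /=; rewrite in_itv/= andbT.
rewrite ge0_integralZl//.
- by rewrite integral_indic// setIT.
- exact/measurable_EFinP.
- by rewrite lee_fin divr_ge0// addr_ge0// ltW.
Qed.

End LayerCake.

(** * Shadowed-Rician fading *)

Section Kummer.
Context {R : realType}.
Implicit Types x t : R.

Lemma pochhammer_nat (m n : nat) :
  pochhammer (m.+1%:R : R) n = ('C(m + n, n) * n`!)%:R.
Proof.
rewrite bin_ffact /pochhammer; elim: n => [|n ih]; first by rewrite big_ord0
  addn0 ffactn0.
rewrite big_ord_recr/= ih -natrD -natrM addnS addSn ffactnS; congr (_%:R).
by rewrite mulnC.
Qed.

Lemma pochhammer_opp_nat (m n : nat) :
  pochhammer (1 - m.+1%:R : R) n = (-1) ^+ n * ('C(m, n) * n`!)%:R.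
Proof.
rewrite bin_ffact /pochhammer; elim: n => [|n ih]; first by rewrite big_ord0
  expr0 mul1r ffactn0.
rewrite big_ord_recr/= ih ffactnSr natrM exprS.
have [nm|mn] := leqP n m; first by rewrite natrB// -natr1; ring.
by rewrite (ffact_small mn) !mul0r !mulr0 mul0r.
Qed.

(** In Kummer's product the term of degree j meets the exponential series j orders late. With the
    delay built into the series, partial sums can be compared order by order. *)
Lemma cvg_series_shifted_exp (j : nat) x :
  series (fun n => if (j <= n)%N then exp_coeff x (n - j)%N else 0) @ \oo -->
    expR x.
Proof.
rewrite -(cvg_shiftn j).
rewrite (_ : (fun n => _) = series (exp_coeff x)).
  exact: is_cvg_series_exp_coeff.
apply/funext => n; rewrite /series/= addnC /index_iota subn0 iotaD big_cat/=
  add0n.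
rewrite big_seq big1 ?add0r; last first.
  by move=> i; rewrite mem_iota add0n => /andP[_ ij]; rewrite leqNgt ij.
rewrite -[X in iota X n]addn0 iotaDl big_map subn0; apply: eq_bigr => i _.
by rewrite leq_addr addKn.
Qed.

(* Kummer's transformation: the coefficient of [x ^+ n] on both sides is matched
   by Vandermonde's identity. *)
Lemma hyp1F1_nat (m : nat) x :
  hyp1F1 m.+1%:R 1 x = expR x * \sum_(z < m.+1) 'C(m, z)%:R / z`!%:R * x ^+ z.
Proof.
rewrite /hyp1F1; apply/cvg_lim => //.
rewrite (_ : series _ = fun N => \sum_(z < m.+1) ('C(m, z)%:R / z`!%:R * x ^+
  z) *
    series (fun n => if (z <= n)%N then exp_coeff x (n - z)%N else 0) N).
  rewrite mulrC big_distrl/=.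
  apply: (@cvg_big _ _ +%R _ _ _ _ _ _ _ _ _ (fun z N => _)) => [|z _]; [exact:
    add_continuous|]; apply: cvgM; first exact: cvg_cst.
  exact: cvg_series_shifted_exp.
apply/funext => N; rewrite /series/=.
under [RHS]eq_bigr do rewrite big_distrr/=.
rewrite exchange_big/=; apply: eq_bigr => n _.
have fact0 k : (k`!%:R : R) != 0 by rewrite pnatr_eq0 -lt0n fact_gt0.
rewrite pochhammer_nat -[1]/(1%:R) pochhammer_nat add0n binn mul1n natrM
  mulfK//.
rewrite -(binomial.Vandermonde m n n) natr_sum mulr_suml mulr_suml.
pose F z := ('C(m, z)%:R / z`!%:R * x ^+ z) *
  (if (z <= n)%N then exp_coeff x (n - z)%N else 0).
transitivity (\sum_(z < n.+1) F z).
  apply: eq_bigr => z _; rewrite /F -ltnS ltn_ord /exp_coeff.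
  have zn : (z <= n)%N by rewrite -ltnS.
  rewrite natrM bin_sub// -[in x ^+ n](subnKC zn) exprD.
  have -> : ('C(n, z)%:R : R) = n`!%:R / (z`!%:R * (n - z)`!%:R).
    by rewrite -(bin_fact zn) !natrM mulfK// mulf_neq0.
  by rewrite /=; field; rewrite !fact0.
rewrite -(big_mkord xpredT F) -[RHS](big_mkord xpredT F).
(* The ranges of z differ: terms past n vanish by the delay of the series, terms past m because the
   binomial coefficient does. *)
have [nm|mn] := leqP n m.
  rewrite [RHS](big_cat_nat (n := n.+1))//= -[LHS]addr0; congr (_ + _).
  rewrite big_nat big1// => i /andP[ni _].
  by rewrite /F leqNgt ni mulr0.
rewrite (big_cat_nat (n := m.+1))//=; last exact: ltnW.
rewrite -[RHS]addr0; congr (_ + _).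
rewrite big_nat big1// => i /andP[ni _].
by rewrite /F bin_small// !mul0r.
Qed.

(** For t >= 0, multiplying by exp(-t) gives the tail at t of the Gamma law of shape z + 1 and rate
    1. *)
Definition expn_trunc (z : nat) t : R := \sum_(v < z.+1) t ^+ v / v`!%:R.

(** The derivatives of the terms t^v exp(-t) / v! telescope, leaving the one of top degree. *)
Lemma is_derive_expn_trunc z t :
  is_derive t 1 (fun t => expn_trunc z t * expR (- t))
    (- (t ^+ z / z`!%:R * expR (- t))).
Proof.
have dexpN : is_derive t 1 (fun t : R => expR (- t)) (- expR (- t)).
  by apply: is_derive_eq; rewrite mulrN1.
elim: z => [|z ih].
  rewrite (_ : (fun t => _) = (fun t => expR (- t))).
    by rewrite expr0 divr1 mul1r.
  by apply/funext => u; rewrite /expn_trunc big_ord1 expr0 divr1 mul1r.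
rewrite (_ : (fun t => _) = (fun t => expn_trunc z t * expR (- t)) +
    (fun t => z.+1`!%:R^-1 * (t ^+ z.+1 * expR (- t)))); last first.
  apply/funext => u; rewrite /expn_trunc big_ord_recr/= mulrDl; congr (_ + _);
    ring.
have dX : is_derive t 1 (fun t : R => t ^+ z.+1) (z.+1%:R * t ^+ z).
  have := @is_deriveX R R id z.+1 t 1 1 (is_derive_id _ _).
  rewrite (_ : id ^+ z.+1 = fun t : R => t ^+ z.+1); last first.
    by apply/funext => u; rewrite fctE.
  by move=> h; apply: is_derive_eq; rewrite /GRing.scale/= mulr1.
have d2 : is_derive t 1 (fun t => z.+1`!%:R^-1 * (t ^+ z.+1 * expR (- t)))
   (z.+1`!%:R^-1 * (z.+1%:R * t ^+ z * expR (- t) - t ^+ z.+1 * expR (- t))).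
  apply: is_deriveZ; apply: is_derive_eq.
  by rewrite /GRing.scale/=; ring.
apply: is_derive_eq.
rewrite /GRing.scale/= factS natrM.
have f0 : (z`!%:R : R) != 0 by rewrite pnatr_eq0 -lt0n fact_gt0.
have z0 : (z.+1%:R : R) != 0 by rewrite pnatr_eq0.
by rewrite exprS; field; rewrite f0 nat1r z0.
Qed.

End Kummer.

Section GammaNat.
Context {R : realType}.

Lemma cvg_expn_trunc (z : nat) :
  (fun t : R => expn_trunc z t * expR (- t)) @ +oo --> 0.
Proof.
have h v : (fun t : R => t ^+ v * expR (- t)) @ +oo --> 0.
  apply/cvgrPdist_le => e e0; near=> t.
  have t0 : 0 < t by near: t; exact: nbhs_pinfty_gt.
  rewrite sub0r normrN ger0_norm; last by rewrite mulr_ge0 ?exprn_ge0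
    ?expR_ge0// ltW.
  rewrite expRN ler_pdivrMr ?expR_gt0//.
  have := @expR_ge1Dxn R t v (ltW t0).
  have f0 : 0 < (v.+1`!%:R : R) by rewrite ltr0n fact_gt0.
  (* As exp t dominates t^(v+1) / (v+1)!, the ratio t^v / exp t is at most e from this threshold
     on. *)
  have te : v.+1`!%:R / e <= t by near: t; apply: nbhs_pinfty_ge; rewrite
    num_real.
  have ge : t ^+ v.+1 / v.+1`!%:R <= expR t.
    by have := @expR_ge1Dxn R t v (ltW t0); lra.
  move=> _; apply: le_trans (ler_wpM2l (ltW e0) ge).
  have -> : e * (t ^+ v.+1 / v.+1`!%:R) = (e * t / v.+1`!%:R) * t ^+ v.
    by rewrite exprS; ring.
  apply: ler_peMl; first by rewrite exprn_ge0// ltW.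
  rewrite ler_pdivlMr// mul1r mulrC.
  by rewrite -ler_pdivrMr.
rewrite (_ : (fun t => _) = fun t : R => \sum_(v < z.+1) v`!%:R^-1 * (t ^+ v *
  expR (- t))).
  rewrite -[X in _ --> X](_ : \sum_(v < z.+1) v`!%:R^-1 * (0 : R) = 0); last
    first.
    by rewrite big1// => v _; rewrite mulr0.
  apply: (@cvg_big _ _ +%R _ _ _ _ _ _
    (fun (v : 'I_z.+1) (t : R) => v`!%:R^-1 * (t ^+ v * expR (- t)))
    (fun v : 'I_z.+1 => v`!%:R^-1 * 0)) => [|v _]; first exact: add_continuous.
  by apply: cvgM; [exact: cvg_cst|exact: h].
apply/funext => t; rewrite /expn_trunc mulr_suml; apply: eq_bigr => v _.
by rewrite mulrA [X in _ = X * _]mulrC.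
Unshelve. all: end_near. Qed.

Lemma expn_trunc0 (z : nat) : expn_trunc z (0 : R) = 1.
Proof.
rewrite /expn_trunc big_ord_recl/= expr0 divr1 big1 ?addr0// => i _.
by rewrite expr0n/= mul0r.
Qed.

(** The function -z! [expn_trunc z t] exp(-t) is an antiderivative of the integrand; it tends to 0
    at infinity and is -z! at 0. *)
Lemma Gamma_nat (z : nat) : Gamma z.+1%:R = z`!%:R :> R.
Proof.
rewrite /Gamma.
rewrite (_ : (fun t : R => _) = (fun t : R => if t > 0 then t ^+ z * expR (- t)
  else t `^ (z.+1%:R - 1) * expR (- t))); last first.
  by apply/funext => t; case: ifPn => // t0; rewrite -natr1 addrK powR_mulrn//
    ltW.
pose g := (fun t : R => t ^+ z * expR (- t)).
have cg : continuous g.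
  move=> t; apply: cvgM; first exact: exprn_continuous.
  by apply: continuous_comp; [exact: opp_continuous|exact: continuous_expR].
have mg : measurable_fun setT g by exact: continuous_measurable_fun.
transitivity (\int[lebesgue_measure]_(t in `]0, +oo[) g t).
  by apply: eq_Rintegral => t; rewrite inE/= in_itv/= andbT => ->.
transitivity (\int[lebesgue_measure]_(t in `[0, +oo[) g t).
  rewrite /Rintegral integral_itv_obnd_cbnd//.
  by apply/measurable_EFinP; exact: measurable_funTS.
have f0 : (z`!%:R : R) != 0 by rewrite pnatr_eq0 -lt0n fact_gt0.
pose F (t : R) := - z`!%:R * (expn_trunc z t * expR (- t)).
have dF (t : R) : is_derive t 1 F (g t).
  have h := is_derive_expn_trunc z t.
  rewrite (_ : g t = (- z`!%:R) *: (- (t ^+ z / z`!%:R * expR (- t)))); last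
    first.
    by rewrite /g /GRing.scale/=; field.
  exact: is_deriveZ.
rewrite (@Rintegral_ge0_continuous_FTC2y R g F 0 0).
- by rewrite /F expn_trunc0 oppr0 expR0 sub0r !mulr1 opprK.
- by move=> t t0; rewrite mulr_ge0 ?exprn_ge0// expR_ge0.
- exact: continuous_subspaceT.
- rewrite -[X in _ --> X](mulr0 (- z`!%:R)); apply: cvgM; first exact: cvg_cst.
  exact: cvg_expn_trunc.
- by move=> t _; have [] := dF t.
- apply: cvg_at_right_filter; apply: differentiable_continuous.
  by apply/derivable1_diffP; have [] := dF 0.
- by move=> t _; rewrite derive1E; have [_ ->] := dF t.
Qed.

End GammaNat.

Section Fading.
Context {R : realType} (S : params R).
Hypotheses (b_gt0 : 0 < sr_b S) (Omega_gt0 : 0 < sr_Omega S) (ms_gt0 : (0 < ms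
  S)%N).

Let ms_gt0' : 0 < (ms S)%:R :> R. Proof. by rewrite ltr0n. Qed.

Let den_gt0 : 0 < 2 * sr_b S * (ms S)%:R + sr_Omega S.
Proof. by rewrite addr_gt0// !mulr_gt0. Qed.

Lemma sr_rate_gt0 : 0 < beta S - sr_c S.
Proof.
rewrite /beta /sr_c (_ : _ - _ = (ms S)%:R / (2 * sr_b S * (ms S)%:R + sr_Omega
  S)).
  exact: divr_gt0.
by field; rewrite !gt_eqF// mulrA.
Qed.

(** Kummer's transformation brings a factor exp(c x^2), which changes the rate beta into beta - c;
    the sign (-1)^z in [zeta] cancels that of the Pochhammer symbol. *)
Lemma shadowed_rician_pdfE x : shadowed_rician_pdf S x =
  \sum_(z < ms S) zeta S z * (2 * x * x ^+ (2 * z) *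
    expR (- ((beta S - sr_c S) * x ^+ 2))).
Proof.
have f0 k : (k`!%:R : R) != 0 by rewrite pnatr_eq0 -lt0n fact_gt0.
rewrite /shadowed_rician_pdf /zeta -(prednK ms_gt0) hyp1F1_nat mulr_sumr
  mulr_sumr.
apply: eq_bigr => z _; rewrite pochhammer_opp_nat natrM.
rewrite (_ : sr_Omega S * x ^+ 2 / _ = sr_c S * x ^+ 2); last first.
  by rewrite /sr_c (prednK ms_gt0); field; rewrite !gt_eqF.
rewrite (_ : - ((beta S - sr_c S) * x ^+ 2) = - (x ^+ 2 / (2 * sr_b S)) + sr_c
  S * x ^+ 2); last first.
  by rewrite /beta; field; rewrite gt_eqF.
rewrite expRD exprMn exprM.
set Cz := 'C(_, _)%:R; set s := (-1) ^+ z.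
have ss : s * s = 1 by rewrite -exprMn mulrNN mulr1 expr1n.
have -> : beta S * s * (s * (Cz * z`!%:R)) = beta S * (Cz * z`!%:R).
  by rewrite -[RHS]mulr1 -ss; ring.
rewrite /sr_const /beta.
move: (_ ^+ ms S) (sr_c S ^+ z) (_ ^+ z) (expR _) (expR _) => K C X e1 e2.
by field; rewrite f0 gt_eqF.
Qed.

(** For t >= 0, the distribution function of the fading power: a combination of those of the Gamma
    laws of shape z + 1 and rate beta - c. *)
Definition sr_cdf (t : R) : R := \sum_(z < ms S)
  zeta S z * z`!%:R / (beta S - sr_c S) ^+ z.+1 *
  (1 - expn_trunc z ((beta S - sr_c S) * t) * expR (- ((beta S - sr_c S) * t))).

Lemma is_derive_sr_cdf (x : R) :
  is_derive x 1 (fun x => sr_cdf (x ^+ 2)) (shadowed_rician_pdf S x).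
Proof.
have k0 := sr_rate_gt0; rewrite shadowed_rician_pdfE.
set k := beta S - sr_c S in k0 *.
rewrite (_ : (fun x => _) = \sum_(z < ms S) (fun x => zeta S z * z`!%:R / k ^+
  z.+1 *
  (1 - expn_trunc z (k * x ^+ 2) * expR (- (k * x ^+ 2))))); last first.
  by apply/funext => y; rewrite /sr_cdf fct_sumE.
apply: is_derive_sum => z.
have dsq : is_derive x 1 (fun x : R => k * x ^+ 2) (k * (2 * x)).
  by apply: is_derive_eq; rewrite /GRing.scale/=; ring.
have dc : is_derive x 1 (fun x : R => expn_trunc z (k * x ^+ 2) * expR (- (k *
  x ^+ 2)))
    (k * (2 * x) * - ((k * x ^+ 2) ^+ z / z`!%:R * expR (- (k * x ^+ 2)))).
  have := @is_derive1_comp R (fun t => expn_trunc z t * expR (- t)) (fun x : R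
    => k * x ^+ 2) x _ _
    (is_derive_expn_trunc z (k * x ^+ 2)) dsq.
  by move=> h; apply: is_derive_eq; rewrite mulrC.
apply: is_derive_eq; rewrite /GRing.scale/= exprMn exprS exprM.
have f0 : (z`!%:R : R) != 0 by rewrite pnatr_eq0 -lt0n fact_gt0.
have kz0 : k ^+ z != 0 by rewrite expf_neq0// gt_eqF.
by field; rewrite f0 kz0 gt_eqF.
Qed.

Lemma continuous_shadowed_rician_pdf : continuous (shadowed_rician_pdf S).
Proof.
rewrite (_ : shadowed_rician_pdf S = fun x => \sum_(z < ms S) zeta S z *
  (2 * x * x ^+ (2 * z) * expR (- ((beta S - sr_c S) * x ^+ 2)))); last first.
  by apply/funext => x; rewrite shadowed_rician_pdfE.
apply: (@continuous_big _ _ +%R) => [|z _]; first exact: add_continuous.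
move=> x; apply: cvgM; first exact: cvg_cst.
apply: cvgM.
  by apply: cvgM; [apply: cvgM; [exact: cvg_cst|exact: cvg_id]|exact:
    exprn_continuous].
apply: continuous_comp; last exact: continuous_expR.
apply: (@continuousN _ _ _ (fun x : R => (beta S - sr_c S) * x ^+ 2)).
by apply: cvgM; [exact: cvg_cst|exact: exprn_continuous].
Qed.

Lemma sr_cdf0 : sr_cdf 0 = 0.
Proof.
rewrite /sr_cdf big1// => z _.
by rewrite mulr0 expn_trunc0 oppr0 expR0 mulr1 subrr mulr0.
Qed.

Lemma integral_shadowed_rician_pdf (a : R) : 0 <= a ->
  (\int[lebesgue_measure]_(x in `[0%R, a] `&` `]0%R, +oo[)
     (shadowed_rician_pdf S x)%:E = (sr_cdf (a ^+ 2))%:E)%E.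
Proof.
move=> a0; rewrite (_ : _ `&` _ = `]0, a]%classic); last first.
  apply/seteqP; split => x /=; rewrite !in_itv/= andbT.
    by move=> [/andP[_ ->] ->].
  by move=> /andP[x0 ->]; rewrite x0 ltW.
rewrite integral_itv_obnd_cbnd; last first.
  apply/measurable_EFinP; apply: measurable_funTS.
  exact: continuous_measurable_fun continuous_shadowed_rician_pdf.
move: a0; rewrite le_eqVlt => /orP[/eqP <-|a0].
  by rewrite set_itv1 integral_set1 expr0n/= sr_cdf0.
rewrite (@continuous_FTC2 R _ (fun x => sr_cdf (x ^+ 2)))//.
- by rewrite -EFinB expr0n/= sr_cdf0 subr0.
- exact/continuous_subspaceT/continuous_shadowed_rician_pdf.
- have cF (x : R) : (fun y : R => sr_cdf (y ^+ 2)) @ x --> sr_cdf (x ^+ 2).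
    have /derivable1_diffP/differentiable_continuous :
      derivable (fun y : R => sr_cdf (y ^+ 2)) x 1 by have [] :=
        is_derive_sr_cdf x.
    exact.
  split.
  + by move=> x _; have [] := is_derive_sr_cdf x.
  + by apply: cvg_at_right_filter; exact: cF.
  + by apply: cvg_at_left_filter; exact: cF.
- by move=> x _; rewrite derive1E; have [_ ->] := is_derive_sr_cdf x.
Qed.

Lemma fading_tail d (T : measurableType d) (P : probability T R) (h : T -> R)
  (t : R) :
  shadowed_rician_power S P h -> 0 <= t ->
  P [set w | t < h w] = (1 - sr_cdf t)%:E.
Proof.
move=> [mh h0 hE] t0.
(* The law is prescribed for the amplitude, so the power is at most t exactly when the amplitude
   lies in this interval. *)
have := hE `[0, Num.sqrt t]%classic (measurable_itv _).
rewrite integral_shadowed_rician_pdf ?sqrtr_ge0// sqr_sqrtr//.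
rewrite (_ : [set w | _] = ~` [set w | t < h w]); last first.
  apply/seteqP; split => w /=; rewrite in_itv/= sqrtr_ge0/= ler_sqrt// leNgt.
    by move/negP.
  by move=> /negP.
move=> PE.
have mt : measurable [set w | t < h w].
  rewrite (_ : [set w | _] = setT `&` h @^-1` `]t, +oo[); first exact: mh.
  by rewrite setTI; apply/seteqP; split => w /=; rewrite in_itv/= andbT.
by rewrite -[in LHS](setCK [set w | t < h w]) probability_setC ?PE//; exact:
  measurableC.
Qed.

End Fading.

(** * Laplace transforms *)

Section Laplace.
Context {R : realType}.
Variable kappa : {measure set R -> \bar R}.
Hypotheses (k1 : kappa [set: R] = 1%E) (kneg : kappa `]-oo, 0[%classic = 0%E).

Let B : set R := `[0, +oo[%classic.

Let mB : measurable B. Proof. exact: measurable_itv. Qed.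

Let setDB : [set: R] `\` `]-oo, 0[%classic = B.
Proof.
by apply/seteqP; split => x; rewrite /B /= !in_itv/= andbT; [move=> [_ /negP];
  rewrite -leNgt|
  move=> x0; split => //; apply/negP; rewrite -leNgt].
Qed.

Let kB : kappa B = 1%E.
Proof.
have := measureDI kappa measurableT (measurable_itv `]-oo, (0:R)[).
rewrite setTI [X in (_ + X)%E]kneg adde0 setDB => <-; exact: k1.
Qed.

Let kBfin : (kappa B < +oo)%E. Proof. by rewrite kB ltry. Qed.

Lemma ge0_integral_nneg (g : R -> \bar R) : measurable_fun [set: R] g ->
  (forall x, 0 <= g x)%E ->
  (\int[kappa]_x g x = \int[kappa]_(x in B) g x)%E.
Proof.
move=> mg g0; rewrite (ge0_negligible_integral (measurable_itv `]-oo,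
  (0:R)[))//.
by rewrite setDB.
Qed.

(** The n-th derivative of exp(-s x) with respect to s. *)
Let mon n (s x : R) : R := (- x) ^+ n * expR (- (s * x)).

Let measurable_mon n s : measurable_fun [set: R] (mon n s).
Proof.
apply: measurable_funM.
  by apply: measurable_funX; exact: measurable_funN.
apply: (measurableT_comp (@measurable_expR R)).
by apply: measurable_funN; exact: measurable_funM.
Qed.

(** From (a x)^n / n! <= exp(a x). The bound depends neither on x nor on s >= a, so it is an
    integrable majorant for differentiation under the integral. *)
Let mon_bound n (a s x : R) : 0 < a -> a <= s -> 0 <= x ->
  `|mon n s x| <= n`!%:R / a ^+ n.
Proof.
move=> a0 ras x0; rewrite /mon normrM normrX normrN (ger0_norm x0) (ger0_norm
  (expR_ge0 _)).
have f0 : 0 < (n`!%:R : R) by rewrite ltr0n fact_gt0.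
apply: (@le_trans _ _ (x ^+ n * expR (- (a * x)))).
  by rewrite ler_wpM2l ?exprn_ge0// ler_expR lerN2 ler_wpM2r.
rewrite expRN ler_pdivrMr ?expR_gt0// mulrAC ler_pdivlMr ?exprn_gt0// -exprMn
  mulrC.
have [n0|n0] := posnP n.
  by rewrite n0 expr0 mul1r -expR0 ler_expR mulr_ge0// ltW.
have := @expR_ge1Dxn R (a * x) n.-1 (mulr_ge0 (ltW a0) x0); rewrite prednK// =>
  h.
have : (a * x) ^+ n / n`!%:R <= expR (a * x) by lra.
by rewrite ler_pdivrMr// [X in _ -> _ <= X]mulrC.
Qed.

Let integrable_mon n (s : R) : 0 < s -> kappa.-integrable B (EFin \o mon n s).
Proof.
move=> s0; apply: measurable_bounded_integrable => //.
  exact: measurable_funTS.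
exists (n`!%:R / s ^+ n); split; first exact: num_real.
move=> y ny x; rewrite /B/= in_itv/= andbT => x0.
by rewrite (le_trans (mon_bound n s0 (lexx s) x0))// ltW.
Qed.

Let mon_derive n (s x : R) : is_derive s 1 (mon n ^~ x) (mon n.+1 s x).
Proof.
have d1 : is_derive s 1 (fun s => - (s * x)) (- x).
  by apply: is_derive_eq; rewrite /GRing.scale/= ?mulr1 ?mulr0 ?add0r ?addr0.
have d2 := @is_derive1_comp R (@expR R) (fun s => - (s * x)) s _ _
  (is_derive_expR _) d1.
rewrite (_ : mon n ^~ x = (- x) ^+ n \*: (fun s => expR (- (s * x)))); last by
  [].
apply: is_derive_eq; rewrite /mon exprS /GRing.scale/=; ring.
Qed.

Let derive_mon n (s : R) : 0 < s ->
  is_derive s 1 (fun s => \int[kappa]_(x in B) mon n s x) (\int[kappa]_(x in B)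
    mon n.+1 s x).
Proof.
move=> s0.
(* Differentiation takes place on ]s/2, 2s[, which stays away from 0, where the bound of [mon_bound]
   blows up. *)
have s2 : 0 < s / 2 by rewrite divr_gt0.
have Is : `](s / 2), (2 * s)[%classic s.
  by rewrite /= in_itv/=; apply/andP; split; lra.
have intf t : `](s / 2), (2 * s)[%classic t -> kappa.-integrable B (EFin \o mon
  n t).
  by rewrite /= in_itv/= => /andP[ts _]; apply: integrable_mon; exact: lt_trans
    ts.
have derf t x : `](s / 2), (2 * s)[%classic t -> B x -> derivable (mon n ^~ x)
  t 1.
  by move=> _ _; have [] := mon_derive n t x.
have dE t x : 'D_1 (mon n ^~ x) t = mon n.+1 t x by have [_ ->] := mon_derive n
  t x.
pose G (_ : R) : R := n.+1`!%:R / (s / 2) ^+ n.+1.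
have G0 x : 0 <= G x by rewrite /G divr_ge0// exprn_ge0// ltW.
have intG : kappa.-integrable B (EFin \o G).
  apply: measurable_bounded_integrable => //; first exact: measurable_cst.
  exists (G 0); split; first exact: num_real.
  by move=> y Gy x _; apply: ltW; rewrite (ger0_norm (G0 x)).
have Gub t x : `](s / 2), (2 * s)[%classic t -> B x -> `|partial1of2 (mon n) t
  x| <= G x.
  rewrite /= in_itv/= => /andP[ts _]; rewrite /B/= in_itv/= andbT => x0.
  by rewrite partial1of2E dE; apply: mon_bound => //; exact: ltW.
apply: DeriveDef.
  exact: (derivable_under_integral mB Is intf derf G0 intG Gub).
rewrite -derive1E (differentiation_under_integral mB Is intf derf G0 intG Gub).
by apply: eq_Rintegral => x _; rewrite partial1of2E dE.
Qed.

Variable L : R -> R.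
Hypothesis LE : forall s, 0 < s -> L s = \int[kappa]_x expR (- (s * x)).

Lemma derive1n_laplace v (s : R) : 0 < s ->
  derive1n v L s = \int[kappa]_(x in B) ((- x) ^+ v * expR (- (s * x))).
Proof.
elim: v s => [|v ih] s s0.
  rewrite derive1n0 LE// /Rintegral ge0_integral_nneg.
  - by congr fine; apply: eq_integral => x _; rewrite expr0 mul1r.
  - apply/measurable_EFinP; apply: (measurableT_comp (@measurable_expR R)).
    by apply: measurable_funN; exact: measurable_funM.
  - by move=> x; rewrite lee_fin expR_ge0.
rewrite derive1nS derive1E.
(* The induction hypothesis holds at positive arguments only, hence just near s. *)
rewrite (@near_eq_derive R R R _ (fun s => \int[kappa]_(x in B) mon v s x)).
  by have [_ ->] := derive_mon v s0.
by near=> t; apply: ih; near: t; exact: lt_nbhsr.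
Unshelve. all: end_near. Qed.

(** Integrability and value travel together, so that linear combinations preserve both at once. *)
Let has_int (f : R -> R) (a : R) :=
  kappa.-integrable B (EFin \o f) /\ \int[kappa]_(x in B) f x = a.

Let has_int_cst c : has_int (cst c) c.
Proof.
split; last by rewrite Rintegral_cst// kB mulr1.
apply: measurable_bounded_integrable => //.
exists `|c|; split; first exact: num_real.
by move=> y cy x _; exact: ltW.
Qed.

Let has_intB f g a b : has_int f a -> has_int g b -> has_int (fun x => f x - g
  x) (a - b).
Proof.
move=> [intf <-] [intg <-]; split; last by rewrite RintegralB.
rewrite (_ : EFin \o _ = (EFin \o f) \- (EFin \o g))%E//.
exact: integrableB.
Qed.

Let has_intZ c f a : has_int f a -> has_int (fun x => c * f x) (c * a).
Proof.
move=> [intf <-]; split; last by rewrite RintegralZl.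
rewrite (_ : EFin \o _ = (fun x => c%:E * (EFin \o f) x))%E//.
exact: integrableZl.
Qed.

Let has_int_sum n (f : nat -> R -> R) (a : nat -> R) : (forall i, has_int (f i)
  (a i)) ->
  has_int (fun x => \sum_(i < n) f i x) (\sum_(i < n) a i).
Proof.
move=> h; elim: n => [|n ih].
  rewrite big_ord0 (_ : (fun _ => _) = cst 0); first exact: has_int_cst.
  by apply/funext => x; rewrite big_ord0.
rewrite big_ord_recr/= -[a n]opprK.
have h1 := has_intB ih (has_intZ (-1) (h n)); rewrite mulN1r in h1.
rewrite (_ : (fun _ => _) = fun x => \sum_(i < n) f i x - -1 * f n x)//.
by apply/funext => x; rewrite big_ord_recr/= mulN1r opprK.
Qed.

(** The term (k c y)^v exp(-k c y) is (k c)^v (-1)^v times [mon v (k c) y], whose integral is the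
    v-th derivative of [L] at k c. The closed form of [g] is assumed on y >= 0 only, which carries
    all the mass of [kappa]. *)
Lemma integral_mixed_tail (m : nat) (A : nat -> R) (k c : R) (g : R -> R) :
  0 < k -> 0 < c -> measurable_fun [set: R] g -> (forall y, 0 <= g y) ->
  (forall y, 0 <= y -> g y = 1 - \sum_(z < m) A z *
     (1 - expn_trunc z (k * y) * expR (- (k * y)))) ->
  (\int[kappa]_y (g (c * y))%:E)%E =
  (1 - \sum_(z < m) A z * (1 - \sum_(v < z.+1)
     (k * c) ^+ v / v`!%:R * (-1) ^+ v * derive1n v L (k * c)))%:E.
Proof.
move=> k0 c0 mg g0 gE.
have kc0 : 0 < k * c by rewrite mulr_gt0.
rewrite ge0_integral_nneg; last 2 first.
- by apply/measurable_EFinP; apply: (measurableT_comp mg); exact: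
  measurable_funM.
- by move=> y; rewrite lee_fin.
pose h y := 1 - \sum_(z < m) A z * (1 - \sum_(v < z.+1)
   ((k * c) ^+ v / v`!%:R * (-1) ^+ v) * mon v (k * c) y).
have [inth <-] : has_int h (1 - \sum_(z < m) A z * (1 - \sum_(v < z.+1)
     (k * c) ^+ v / v`!%:R * (-1) ^+ v * derive1n v L (k * c))).
  apply: has_intB; first exact: has_int_cst.
  apply: (@has_int_sum m (fun z y => A z * (1 - \sum_(v < z.+1)
       ((k * c) ^+ v / v`!%:R * (-1) ^+ v) * mon v (k * c) y))
    (fun z => A z * (1 - \sum_(v < z.+1)
       (k * c) ^+ v / v`!%:R * (-1) ^+ v * derive1n v L (k * c)))) => z.
  apply: has_intZ; apply: has_intB; first exact: has_int_cst.
  apply: (@has_int_sum z.+1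
    (fun v y => ((k * c) ^+ v / v`!%:R * (-1) ^+ v) * mon v (k * c) y)
    (fun v => ((k * c) ^+ v / v`!%:R * (-1) ^+ v) * derive1n v L (k * c))) => v.
  by apply: has_intZ; split; [exact: integrable_mon|rewrite derive1n_laplace].
transitivity (\int[kappa]_(x in B) (EFin \o h) x)%E; last first.
  by rewrite /Rintegral fineK//; exact: integrable_fin_num.
apply: eq_integral => y; rewrite inE /B/= in_itv/= andbT => y0.
rewrite /= gE ?mulr_ge0 ?(ltW c0)// /h; congr (_%:E).
congr (1 - _); apply: eq_bigr => z _; congr (_ * (1 - _)).
rewrite /expn_trunc mulr_suml; apply: eq_bigr => v _.
rewrite /mon [k * (c * y)]mulrA exprMn [(- y) ^+ v]exprNn.
have sg : (-1) ^+ v * (-1) ^+ v = 1 :> R by rewrite -exprMn mulrNN mulr1 expr1n.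
move: (expR _) => e.
transitivity ((k * c) ^+ v * y ^+ v / v`!%:R * e * ((-1) ^+ v * (-1) ^+ v)).
  by rewrite sg mulr1.
by move: (_ ^+ v) (_ ^+ v) ((-1) ^+ v) => p q t; ring.
Qed.

End Laplace.

(** * Spherical caps and Poisson processes *)

Section Geometry.
Context {R : realType} (S : params R).
Hypothesis hS : valid_params S.
Variable o : node.

Let Rs0 : 0 < Rs S. Proof. by have [[]] := hS. Qed.
Let rho0 : 0 < Rad S o. Proof. by have [[_ /(_ o)[]]] := hS. Qed.
Let rhoRs : Rad S o < Rs S. Proof. by have [[_ /(_ o)[]]] := hS. Qed.

Lemma dist_ge0 u : 0 <= dist S u. Proof. exact: sqrtr_ge0. Qed.

Lemma sqr_dist u : sphere (Rad S o) u ->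
  dist S u ^+ 2 = Rad S o ^+ 2 + Rs S ^+ 2 - 2 * Rs S * u.2.
Proof.
case: u => [[x y] z]; rewrite /sphere /= /dist /norm3 => <-.
have pos a b c : 0 <= @dot3 R (a, b, c) (a, b, c).
  by rewrite /dot3/= !addr_ge0// -expr2 sqr_ge0.
rewrite (_ : (x, y, z) - x1 S = (x - 0, y - 0, z - Rs S))//.
by rewrite !sqr_sqrtr// /dot3/=; ring.
Qed.

Lemma Rmin_gt0 : 0 < Rmin S o. Proof. by rewrite subr_gt0. Qed.

Lemma dist_ge_Rmin u : sphere (Rad S o) u -> Rmin S o <= dist S u.
Proof.
move=> su; rewrite -(@ler_pXn2r _ 2) ?nnegrE ?dist_ge0 ?(ltW Rmin_gt0)//.
rewrite sqr_dist// /Rmin.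
have zrho : u.2 <= Rad S o.
  case: u su => [[x y] z]; rewrite /sphere /norm3 /dot3 /= => <-.
  apply: (le_trans (ler_norm _)); rewrite -sqrtr_sqr ler_wsqrtr// expr2.
  by rewrite lerDr addr_ge0// -expr2 sqr_ge0.
rewrite -subr_ge0 (_ : _ - _ = 2 * Rs S * (Rad S o - u.2)); last by ring.
by rewrite mulr_ge0 ?subr_ge0// mulr_ge0// ltW.
Qed.

(** Writing M for [Rmax] and rho for the radius, (M - Rs)^2 = rho^2 - 2 Rs M (1 - cos theta) <
    rho^2, since M > 0; so M differs from Rs by less than rho, which is both bounds. *)
Lemma Rmax_bounds : Rmin S o < Rmax S o /\ Rmax S o < Rs S + Rad S o.
Proof.
have [[_ _ _ [t0 tpi] /(_ o) Rt] _ _ _ _] := hS.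
set c := cos (theta S); set s := sin (theta S).
have c0 : 0 < c.
  by apply: cos_gt0_pihalf; rewrite tpi andbT (lt_trans _ t0)// oppr_lt0
    divr_gt0// pi_gt0.
have s0 : 0 < s.
  by apply: sin_gt0_pi; rewrite t0 (lt_le_trans tpi)// ler_pdivrMr// ler_peMr//
    ?pi_ge0// ler1n.
have cs : c ^+ 2 + s ^+ 2 = 1 by exact: cos2Dsin2.
have c2 : c ^+ 2 = 1 - s ^+ 2 by lra.
have c1 : c < 1.
  by rewrite -(@ltr_pXn2r _ 2) ?nnegrE ?(ltW c0)// expr1n -cs ltrDl exprn_gt0.
have arg0 : 0 <= Rad S o ^+ 2 - Rs S ^+ 2 * s ^+ 2.
  rewrite subr_ge0 -exprMn ler_pXn2r ?nnegrE// ?(ltW rho0)// mulr_ge0// ltW//.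
rewrite /Rmax /Rmin -/c -/s; set q := Num.sqrt _.
have q2 : q ^+ 2 = Rad S o ^+ 2 - Rs S ^+ 2 * s ^+ 2 by rewrite sqr_sqrtr.
have q0 : 0 <= q by exact: sqrtr_ge0.
have M0 : q < Rs S * c.
  rewrite -(@ltr_pXn2r _ 2) ?nnegrE// ?mulr_ge0 ?(ltW Rs0) ?(ltW c0)// q2
    exprMn.
  have : Rad S o ^+ 2 < Rs S ^+ 2 by rewrite ltr_pXn2r ?nnegrE ?(ltW Rs0) ?(ltW
    rho0).
  by have -> : Rs S ^+ 2 * c ^+ 2 = Rs S ^+ 2 - Rs S ^+ 2 * s ^+ 2; [rewrite
    c2; ring|lra].
have : (Rs S * c - q - Rs S) ^+ 2 < Rad S o ^+ 2.
  have -> : (Rs S * c - q - Rs S) ^+ 2 = Rad S o ^+ 2 - 2 * Rs S * (Rs S * c -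
    q) * (1 - c).
    rewrite (_ : Rad S o ^+ 2 = q ^+ 2 + Rs S ^+ 2 * (1 - c ^+ 2)); first by
      ring.
    by rewrite q2 c2; ring.
  rewrite ltrBlDr ltrDl !mulr_gt0// ?subr_gt0//.
rewrite -ltr_sqrt ?exprn_gt0// !sqrtr_sqr (gtr0_norm rho0) ltr_norml =>
  /andP[h1 h2].
by split; lra.
Qed.

(** By the law of cosines, the cosine of the polar angle of a point of the sphere at distance r from
    [x1]. *)
Let cosr (r : R) := (Rad S o ^+ 2 + Rs S ^+ 2 - r ^+ 2) / (2 * Rs S * Rad S o).

(** Archimedes: the area of a zone is 2 pi rho^2 times the difference of the cosines of its polar
    angles, and these cosines are affine in the squared distance to [x1]. *)
Lemma surface_area_band (A : set (pt3 R)) (a b : R) :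
  (forall u, sphere (Rad S o) u -> A u <-> a <= dist S u <= b) ->
  Rmin S o <= a -> a <= b -> b <= Rs S + Rad S o ->
  surface_area (Rad S o) A =
  (pi * (Rad S o / Rs S) * (b ^+ 2 - a ^+ 2))%:E.
Proof.
move=> AE Rmina ab bmax.
have a0 : 0 <= a by apply: le_trans Rmina; rewrite ltW// Rmin_gt0.
have den0 : 0 < 2 * Rs S * Rad S o by rewrite !mulr_gt0.
have cosr_itv r : Rmin S o <= r -> r <= Rs S + Rad S o -> -1 <= cosr r <= 1.
  move=> r1 r2; rewrite /cosr ler_pdivlMr// ler_pdivrMr//.
  have r0 : 0 <= r by apply: le_trans r1; rewrite ltW// Rmin_gt0.
  have : r ^+ 2 <= (Rs S + Rad S o) ^+ 2 by rewrite ler_pXn2r ?nnegrE ?addr_ge0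
    ?(ltW Rs0) ?(ltW rho0).
  have : (Rs S - Rad S o) ^+ 2 <= r ^+ 2 by rewrite ler_pXn2r ?nnegrE// (ltW
    Rmin_gt0).
  rewrite sqrrB sqrrD => h1 h2; apply/andP; split; lra.
have ca := cosr_itv _ Rmina (le_trans ab bmax).
have cb := cosr_itv _ (le_trans Rmina ab) bmax.
have b0 := le_trans a0 ab.
pose ta := acos (cosr a); pose tb := acos (cosr b).
have ta_itv : ta \in `[0, pi] by rewrite in_itv/= acos_ge0// acos_lepi.
have tb_itv : tb \in `[0, pi] by rewrite in_itv/= acos_ge0// acos_lepi.
have cta : cos ta = cosr a by rewrite /ta acosK.
have ctb : cos tb = cosr b by rewrite /tb acosK.
pose q t p : pt3 R := (Rad S o * sin t * cos p, Rad S o * sin t * sin p, Rad S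
  o * cos t).
have sq t p : sphere (Rad S o) (q t p).
  rewrite /sphere/= /norm3 /dot3/= (_ : _ + _ = Rad S o ^+ 2).
    by rewrite sqrtr_sqr gtr0_norm.
  have h1 := cos2Dsin2 t; have h2 := cos2Dsin2 p.
  rewrite (_ : _ + _ = Rad S o ^+ 2 * (sin t ^+ 2 * (cos p ^+ 2 + sin p ^+ 2) +
    cos t ^+ 2)); last by ring.
  by rewrite h2 mulr1 addrC h1 mulr1.
have ler_cos x y : x \in `[0, pi] -> y \in `[0, pi] -> (cos x <= cos y :> R) =
  (y <= x).
  by move=> xpi ypi; rewrite leNgt ltr_cos// -leNgt.
have dq t p : dist S (q t p) ^+ 2 = Rad S o ^+ 2 + Rs S ^+ 2 - (2 * Rs S * Rad
  S o) * cos t.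
  by rewrite sqr_dist//= mulrA.
have le_dq t p r : 0 <= r -> (dist S (q t p) <= r) = (cosr r <= cos t).
  move=> r0; rewrite -(@ler_pXn2r _ 2) ?nnegrE ?dist_ge0// dq /cosr
    ler_pdivrMr//.
  by rewrite mulrC; apply/idP/idP; lra.
have dq_le t p r : 0 <= r -> (r <= dist S (q t p)) = (cos t <= cosr r).
  move=> r0; rewrite -(@ler_pXn2r _ 2) ?nnegrE ?dist_ge0// dq /cosr
    ler_pdivlMr//.
  by rewrite mulrC; apply/idP/idP; lra.
have Aq t p : t \in `[0, pi] -> (q t p \in A) = (t \in `[ta, tb]).
  move=> tpi; transitivity (a <= dist S (q t p) <= b).
    by apply/idP/idP; [rewrite inE => /(AE _ (sq t p))|move=> /(AE _ (sq t
      p)).2 Aq; rewrite inE].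
  by rewrite dq_le// le_dq// in_itv/= -cta -ctb !ler_cos.
rewrite /surface_area.
pose K := 2 * pi * Rad S o ^+ 2.
transitivity (\int[lebesgue_measure]_(t in `[0%R, pi])
    ((fun t => (K * sin t)%:E) \_ `[ta, tb]%classic) t)%E.
  apply: eq_integral => t; rewrite inE /= => tpi.
  rewrite (eq_integral (cst (Rad S o ^+ 2 * sin t * (t \in `[ta, tb])%:R)%:E)).
    have mu2 : lebesgue_measure `[0%R, (2 * pi)%R : R]%classic = (2 * pi)%:E :>
      \bar R.
      by rewrite lebesgue_measure_itv/= lte_fin mulr_gt0 ?pi_gt0// oppr0 adde0.
    rewrite integral_cst// [X in (_ * X)%E = _]mu2 -EFinM.
    rewrite patchE mem_setE; case: ifPn => ht; rewrite ?mulr1 ?mulr0 ?mul0r//.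
    by congr (_%:E); rewrite /K; ring.
  by move=> p _ /=; rewrite indicE Aq.
rewrite -integral_mkcondr setIidr; last first.
  apply: subset_itvScc; rewrite bnd_simp; first by move: ta_itv; rewrite
    in_itv/= => /andP[].
  by move: tb_itv; rewrite in_itv/= => /andP[].
have tab : ta <= tb.
  rewrite -ler_cos// cta ctb /cosr ler_pM2r ?invr_gt0// lerB// ler_pXn2r
    ?nnegrE//.
(* A degenerate band is treated apart, the fundamental theorem being applied on a nontrivial
   interval. *)
move: tab; rewrite le_eqVlt => /orP[/eqP tab|tab].
  rewrite tab set_itv1 integral_set1; congr (_%:E).
  have : cosr a = cosr b by rewrite -cta -ctb tab.
  move=> /(mulIf (invr_neq0 (lt0r_neq0 den0))) h.
  have -> : b ^+ 2 - a ^+ 2 = 0 by lra.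
  by rewrite mulr0.
have dF (t : R) : is_derive t 1 (fun t => - K * cos t) (K * sin t).
  by apply: is_derive_eq; rewrite /GRing.scale/=; ring.
have cF (x : R) : (fun t : R => - K * cos t) @ x --> - K * cos x.
  have /derivable1_diffP/differentiable_continuous :
      derivable (fun t : R => - K * cos t) x 1 by have [] := dF x.
  exact.
rewrite (@continuous_FTC2 R _ (fun t => - K * cos t))//.
- rewrite cta ctb -EFinB; congr (_%:E); rewrite /cosr /K; field.
  by rewrite !gt_eqF.
- apply/continuous_subspaceT => x; apply: cvgM; first exact: cvg_cst.
  exact: continuous_sin.
- split.
  + by move=> x _; have [] := dF x.
  + by apply: cvg_at_right_filter; exact: cF.
  + by apply: cvg_at_left_filter; exact: cF.
- by move=> x _; rewrite derive1E; have [_ ->] := dF x.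
Qed.

Lemma surface_area_cap :
  surface_area (Rad S o) (cap S o) =
  (pi * (Rad S o / Rs S) * (Rmax S o ^+ 2 - Rmin S o ^+ 2))%:E.
Proof.
have [h1 h2] := Rmax_bounds.
apply: surface_area_band; rewrite ?lexx ?(ltW h1) ?(ltW h2)// => u su.
rewrite dist_ge_Rmin//=; split => [[]//|]; first by [].
Qed.

End Geometry.

Section Served.
Context {R : realType} (S : params R) d (T : measurableType d).
Variable Phi : node -> point_process T R.

Lemma user_visibleP w : user_visible S Phi w <->
  exists l : 'I_(npts (Phi Us) w), visible S Phi Us l w.
Proof.
rewrite /user_visible /= /Defs.count; split.
  rewrite lt0n; apply: contraNP => /forallNP h.
  by rewrite big1// => l _; case: (boolP (_ \in _)) => // hl; case: (h l).
by move=> [l hl]; rewrite (bigD1 l)//= (_ : pt _ _ _ \in _ = true).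
Qed.

Lemma servedP w : user_visible S Phi w ->
  [/\ (served S Phi w < npts (Phi Us) w)%N, visible S Phi Us (served S Phi w) w
    &
      forall l, (l < npts (Phi Us) w)%N -> visible S Phi Us l w ->
        serving_dist S Phi w <= dist S (pt (Phi Us) l w)].
Proof.
move=> /user_visibleP[l1 vl1]; rewrite /serving_dist /served.
case: pickP => [l0 vl0|/(_ l1)]; last by rewrite vl1.
case: arg_minP => // i vi hi; split => // l ln vl.
exact: (hi (Ordinal ln)).
Qed.

Lemma served_ltn w : user_visible S Phi w -> (served S Phi w < npts (Phi Us)
  w)%N.
Proof. by case/servedP. Qed.

End Served.

Section Poisson.
Context {R : realType} (S : params R) (hS : valid_params S).
Context d (T : measurableType d) (P : probability T R).
Variables (Phi : node -> point_process T R).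
Hypothesis hPhi : forall o, homogeneous_PPP P (Rad S o) (lam S o) (Phi o).

Let mN o : measurable_fun [set: T] (npts (Phi o)).
Proof. by have [[]] := hPhi o. Qed.

Let mpt o l : measurable_fun [set: T] (pt (Phi o) l).
Proof. by have [[]] := hPhi o. Qed.

Let mcount o A (B : set nat) : measurable A -> measurable [set w | B
  (Defs.count (Phi o) A w)].
Proof.
move=> mA; rewrite (_ : [set _ | _] = setT `&` Defs.count (Phi o) A @^-1` B);
  last by rewrite setTI.
by apply: (measurable_count mN mpt).
Qed.

Lemma prob_user_visible : P (user_visible S Phi) =
  (1 - expR (- (lamt S Us * pi * (Rmax S Us ^+ 2 - Rmin S Us ^+ 2))))%:E.
Proof.
have mcap : measurable (cap S Us) by exact: measurable_cap_upto.
have [_ _ /(_ _ mcap 0%N) /= PE _] := hPhi Us.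
move: PE; rewrite expr0 divr1 mul1r surface_area_cap//= => PE.
rewrite (_ : user_visible S Phi = ~` [set w | Defs.count (Phi Us) (cap S Us) w
  = 0%N]).
  rewrite probability_setC ?PE -?EFinB; last exact: (mcount Us [set 0%N]).
  by congr ((1 - expR (- _))%:E); rewrite /lamt; ring.
by apply/seteqP; split => w; rewrite /user_visible /= lt0n => /eqP.
Qed.

Lemma prob_user_visible_gt0 : (0 < P (user_visible S Phi))%E.
Proof.
rewrite prob_user_visible.
have [[Rs0 /(_ Us)[rho0 _] /(_ Us) lam0 _ _] _ _ _ _] := hS.
have [h1 _] := Rmax_bounds hS Us; have h0 := Rmin_gt0 hS Us.
rewrite lte_fin subr_gt0 expR_lt1 oppr_lt0 mulr_gt0//.
  by apply: mulr_gt0; [apply: mulr_gt0 => //; exact: divr_gt0|exact: pi_gt0].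
by rewrite subr_gt0 ltr_pXn2r ?nnegrE ?(ltW h0)// (ltW (lt_trans h0 h1)).
Qed.

Lemma count_ge2 (X : point_process T R) A w l l' :
  (l < npts X w)%N -> (l' < npts X w)%N -> l != l' ->
  pt X l w \in A -> pt X l' w \in A -> (2 <= Defs.count X A w)%N.
Proof.
move=> ln ln' ll' Al Al'; rewrite /Defs.count (bigD1 (Ordinal ln))//= Al.
by rewrite (bigD1 (Ordinal ln'))/= ?Al'// -val_eqE/= eq_sym.
Qed.

(** The probability is 1 - (1 + m) exp(-m), and exp(-m) >= 1 - m bounds it by m^2. *)
Lemma prob_count_ge2 o A m : measurable A -> 0 <= m ->
  lam S o * fine (surface_area (Rad S o) A) = m ->
  (P [set w | (2 <= Defs.count (Phi o) A w)%N] <= (m ^+ 2)%:E)%E.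
Proof.
move=> mA m0 mE; have [_ _ /(_ _ mA) /= PE _] := hPhi o.
have P0 := PE 0%N; have P1 := PE 1%N; rewrite !mE in P0 P1.
rewrite (_ : [set w | _] = ~` ([set w | Defs.count (Phi o) A w = 0%N] `|`
    [set w | Defs.count (Phi o) A w = 1%N])); last first.
  by apply/seteqP; split => w /=; case: (Defs.count _ _ _) => [|[|k]]//;
    [move=> _ []|move=> h; case: h; left|move=> h; case: h; right].
have m0' := mcount o [set 0%N] mA; have m1' := mcount o [set 1%N] mA.
rewrite probability_setC; last exact: measurableU m0' m1'.
rewrite measureU//; last by apply/seteqP; split => w //= [->].
rewrite [X in (1 - (X + _))%E]P0 [X in (1 - (_ + X))%E]P1 .
rewrite -[leLHS]/((1 - (m ^+ 0 / 0`!%:R * expR (- m) + m ^+ 1 / 1`!%:R * expR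
  (- m)))%:E) lee_fin.
rewrite expr0 expr1 !divr1 mul1r.
have h1 : 1 - m <= expR (- m) by exact: expR_ge1Dx.
have : (1 + m) * (1 - m) <= (1 + m) * expR (- m) by rewrite ler_wpM2l//
  addr_ge0.
by lra.
Qed.

(* Two points at the same distance lie in a common annulus of any partition of
   the cap into K annuli of equal area, an event of probability O(1/K). *)
Lemma ties_negligible o : exists N, [/\ measurable N, P N = 0%E &
  forall w l l', (l < npts (Phi o) w)%N -> (l' < npts (Phi o) w)%N -> l != l' ->
    visible S Phi o l w -> visible S Phi o l' w ->
    dist S (pt (Phi o) l w) = dist S (pt (Phi o) l' w) -> N w].
Proof.
have [hmin hmax] := Rmax_bounds hS o; have Rmin0 := Rmin_gt0 hS o.
have lam0 : 0 < lam S o by have [[_ _ /(_ o)]] := hS.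
have Rs0 : 0 < Rs S by have [[]] := hS.
have rho0 : 0 < Rad S o by have [[_ /(_ o)[]]] := hS.
pose D := Rmax S o ^+ 2 - Rmin S o ^+ 2.
have D0 : 0 < D by rewrite subr_gt0 ltr_pXn2r ?nnegrE ?(ltW Rmin0) ?(ltW
  (lt_trans Rmin0 hmin)).
(* The squared radii are equally spaced because the area of a band is proportional to the difference
   of squares. *)
pose r K i := Num.sqrt (Rmin S o ^+ 2 + i%:R / K.+1%:R * D).
have r2 K i : r K i ^+ 2 = Rmin S o ^+ 2 + i%:R / K.+1%:R * D.
  by rewrite sqr_sqrtr// addr_ge0 ?sqr_ge0// mulr_ge0 ?divr_ge0 ?ler0n ?(ltW
    D0).
have r0 K i : 0 <= r K i by exact: sqrtr_ge0.
have rmin K i : Rmin S o <= r K i.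
  rewrite -(@ler_pXn2r _ 2) ?nnegrE ?(ltW Rmin0)// r2 lerDl.
  by rewrite mulr_ge0 ?divr_ge0 ?ler0n ?(ltW D0).
have rmax K i : (i <= K.+1)%N -> r K i <= Rmax S o.
  move=> iK; rewrite -(@ler_pXn2r _ 2) ?nnegrE ?(ltW (lt_trans Rmin0 hmin))//
    r2.
  rewrite -lerBrDl -/D ler_piMl ?(ltW D0)// ler_pdivrMr ?ltr0n// mul1r ler_nat.
  exact: iK.
have rS K i : r K i <= r K i.+1.
  rewrite -(@ler_pXn2r _ 2) ?nnegrE// !r2 lerD2l ler_pM2r// ler_pM2r ?invr_gt0
    ?ltr0n//.
  by rewrite ler_nat.
pose B K i := cap_upto S o (r K i.+1) `&` [set u | r K i <= dist S u].
have mB K i : measurable (B K i).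
  apply: measurableI; first exact: measurable_cap_upto.
  rewrite (_ : [set u | _] = setT `&` dist S @^-1` `[r K i, +oo[).
    by apply: measurable_dist.
  by rewrite setTI; apply/seteqP; split => u /=; rewrite in_itv/= andbT.
pose M := lam S o * (pi * (Rad S o / Rs S) * D).
have M0 : 0 <= M.
  by rewrite mulr_ge0 ?(ltW lam0)// mulr_ge0 ?(ltW D0)// mulr_ge0 ?pi_ge0//
    divr_ge0// ltW.
have PB K i : (i < K.+1)%N ->
    (P [set w | (2 <= Defs.count (Phi o) (B K i) w)%N] <= ((M / K.+1%:R) ^+
      2)%:E)%E.
  move=> iK; apply: prob_count_ge2 => //; first by rewrite divr_ge0.
  rewrite (surface_area_band hS (a := r K i) (b := r K i.+1))//=; last 2 first.
  - move=> u su; rewrite /B /cap_upto; split => [[[_ /= ->] /= ->]//|/andP[h1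
    h2]].
    by split.
  - by rewrite (le_trans (rmax _ _ iK))// ltW.
  rewrite !r2 /M -natr1; field.
  by rewrite nat1r pnatr_eq0/= gt_eqF.
pose U K := \big[setU/set0]_(i < K.+1) [set w | (2 <= Defs.count (Phi o) (B K
  i) w)%N].
have mU K : measurable (U K).
  by apply: bigsetU_measurable => i _; exact: (mcount o [set n | (2 <= n)%N]).
have PU K : (P (U K) <= (M ^+ 2 / K.+1%:R)%:E)%E.
  apply: (le_trans (@Boole_inequality _ _ _ P (fun i => [set w | (2 <=
    Defs.count (Phi o) (B K i) w)%N]) K.+1 _)).
    by move=> i _; exact: (mcount o [set n | (2 <= n)%N]).
  apply: (@le_trans _ _ (\sum_(i < K.+1) ((M / K.+1%:R) ^+ 2)%:E)%E).
    by apply: lee_sum => i _; exact: PB.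
  rewrite sumEFin lee_fin big_const_ord iter_addr_0 -mulr_natr.
  rewrite le_eqVlt; apply/orP; left; apply/eqP; rewrite -natr1; field.
  by rewrite ?nat1r ?natr1 pnatr_eq0.
exists (\bigcap_K U K); split.
- exact: bigcapT_measurable.
- have mI : measurable (\bigcap_K U K) by exact: bigcapT_measurable.
  have le K : (P (\bigcap_K U K) <= (M ^+ 2 / K.+1%:R)%:E)%E.
    apply: le_trans (PU K); apply: le_measure; rewrite ?inE//.
    by move=> w; exact.
  have fin : P (\bigcap_K U K) \is a fin_num by exact: fin_num_measure.
  apply/eqP; rewrite eq_le measure_ge0 andbT leNgt; apply/negP => P0.
  move: le P0; rewrite -(fineK fin) lte_fin; set p := fine _ => le p0.
  (* For this K, K + 1 exceeds M^2 / p, so the bound M^2 / (K + 1) falls below p. *)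
  have := le (Num.truncn (M ^+ 2 / p)).
  rewrite lee_fin ler_pdivlMr ?ltr0n// leNgt => /negP; apply.
  rewrite mulrC -ltr_pdivrMr//.
  by have /truncn_itv/andP[_] : 0 <= M ^+ 2 / p by rewrite divr_ge0 ?sqr_ge0//
    ltW.
move=> w l l' ln ln' ll' /set_mem vl /set_mem vl' dd K _.
set u := pt (Phi o) l w in vl dd *; set u' := pt (Phi o) l' w in vl' dd *.
have [su du] := vl; have [su' du'] := vl'.
have [i iK /andP[ri ri1]] : exists2 i, (i < K.+1)%N & r K i <= dist S u <= r K
  i.+1.
  have dge := dist_ge_Rmin hS su.
  have d0 : 0 <= dist S u := dist_ge0 S u.
  (* The position of the squared distance in units of one annulus; its integer part is the index of
     the annulus. *)
  pose x := K.+1%:R * ((dist S u ^+ 2 - Rmin S o ^+ 2) / D).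
  have K0 : 0 < K.+1%:R :> R by rewrite ltr0n.
  have x0 : 0 <= x.
    by rewrite mulr_ge0// divr_ge0 ?(ltW D0)// subr_ge0 ler_pXn2r ?nnegrE ?(ltW
      Rmin0).
  have xE : dist S u ^+ 2 = Rmin S o ^+ 2 + x / K.+1%:R * D.
    by rewrite /x; move: (K.+1%:R : R) K0 => k k0; field; rewrite !gt_eqF.
  have cmp i y : 0 <= i%:R :> R -> ((i%:R / K.+1%:R * D <= y / K.+1%:R * D) =
    (i%:R <= y :> R)) *
       ((y / K.+1%:R * D <= i%:R / K.+1%:R * D) = (y <= i%:R :> R)).
    by move=> _; rewrite !ler_pM2r ?invr_gt0.
  have [xK|Kx] := ltP x K.+1%:R.
    have /andP[h1 h2] := truncn_itv x0.
    exists (Num.truncn x); first by rewrite -(ltr_nat R) (le_lt_trans h1).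
    rewrite -(@ler_pXn2r _ 2) ?nnegrE// -(@ler_pXn2r _ 2 isT (dist S u))
      ?nnegrE//.
    by rewrite !r2 xE !lerD2l !cmp ?ler0n// h1 ltW.
  (* The outer boundary, where x = K + 1, belongs to the last annulus. *)
  exists K => //.
  have dM : dist S u <= Rmax S o by [].
  rewrite -(@ler_pXn2r _ 2) ?nnegrE// -(@ler_pXn2r _ 2 isT (dist S u))
    ?nnegrE//.
  rewrite !r2 {1}xE !lerD2l !cmp ?ler0n// (le_trans _ Kx) ?ler_nat//=.
  rewrite divff ?gt_eqF// mul1r /D addrC subrK.
  by rewrite ler_pXn2r ?nnegrE// ltW// (lt_trans Rmin0).
rewrite /U -(bigcup_mkord K.+1
  (fun i => [set w | (2 <= Defs.count (Phi o) (B K i) w)%N])).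
exists i => //=.
have Bu : B K i u by split; first split.
have Bu' : B K i u' by rewrite /B /cap_upto; split; [split => //|]; rewrite /=
  -dd.
exact: (count_ge2 ln ln' ll' (mem_set Bu) (mem_set Bu')).
Qed.

End Poisson.

(** * Conditioning on the network *)

Section ServedTail.
Context {R : realType} (S : params R) d (T : measurableType d) (P : probability
  T R).
Variables (Phi : node -> point_process T R) (H : node -> nat -> T -> R).
Hypothesis hnet : network S P Phi H.

Lemma network_measurable :
  [/\ forall o, measurable_fun [set: T] (npts (Phi o)),
      forall o l, measurable_fun [set: T] (pt (Phi o) l) &
      forall o l, measurable_fun [set: T] (H o l)].
Proof.
have [hPhi _ hH _] := hnet; split => [n|n l|n l].
- by have [[]] := hPhi n.
- by have [[]] := hPhi n.
- by have [] := hH n l.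
Qed.

Let mN : forall o, measurable_fun [set: T] (npts (Phi o)).
Proof. by case: network_measurable. Qed.
Let mpt : forall o l, measurable_fun [set: T] (pt (Phi o) l).
Proof. by case: network_measurable. Qed.
Let mH : forall o l, measurable_fun [set: T] (H o l).
Proof. by case: network_measurable. Qed.

(* The noise power is included. *)
Definition interference (o : mode) (w : T) : R := I_s S Phi H w + I_t S Phi H o
  w + sigma2 S.

Definition served_event (k : nat) : set T :=
  user_visible S Phi `&` [set w | served S Phi w = k].

Lemma measurable_interference o : measurable_fun [set: T] (interference o).
Proof.
apply: measurable_funD => //; apply: measurable_funD.
  exact: measurable_I_s.
exact: measurable_I_t.
Qed.

Lemma measurable_served_event k : measurable (served_event k).
Proof.
apply: measurableI; first exact: measurable_user_visible.
rewrite (_ : [set w | _] = setT `&` served S Phi @^-1` [set k]); last by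
  rewrite setTI.
by apply: (measurable_served S mN mpt).
Qed.

Section FixedLabel.
Variable k : nat.

Let F := fading_and_points Phi H.
Let G := \bigcup_(i in [set i | i != Some (Us, k)]) F i.
(** The same sample space, with only the events that do not involve the fading of label [k]. The
    measurability lemmas on networks hold over any measurable type, so they apply over [T'] to a
    modified network. *)
Let T' := g_sigma_algebraType G.

Let memG (i : option (node * nat)) (A : set T) : i != Some (Us, k) -> F i A ->
  measurable (A : set T').
Proof. by move=> ik FA; apply: sub_sigma_algebra; exists i. Qed.

Let mpts (o : node) (l : nat) (A : set (pt3 R)) : measurable A ->
  measurable ([set w | (l < npts (Phi o) w)%N /\ A (pt (Phi o) l w)] : set T').
Proof.
move=> mA; apply: (@memG None) => //; apply: sub_sigma_algebra.
by exists o, l, A.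
Qed.

Let mltn (o : node) (l : nat) : measurable ([set w | (l < npts (Phi o) w)%N] :
  set T').
Proof.
rewrite (_ : [set w | _] = [set w | (l < npts (Phi o) w)%N /\ [set: pt3 R] (pt
  (Phi o) l w)]).
  exact: mpts.
by apply/seteqP; split => w //= -[].
Qed.

(* [Phi'] forgets the values of [pt] beyond [npts], and [H'] the fading of the
   served user, so that both are measurable for the sub-sigma-algebra [G]. *)
Let Phi' (o : node) : point_process T' R :=
  @PointProcess _ T' R (npts (Phi o))
    (fun l w => if (l < npts (Phi o) w)%N then pt (Phi o) l w else (0, 0, 0)).

Let H' (o : node) (l : nat) : T' -> R :=
  if (o, l) == (Us, k) then cst 0 else H o l.

Let mN' o : measurable_fun [set: T'] (npts (Phi' o)).
Proof.
move=> _ A _; rewrite setTI.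
(* [sigma_points] knows [npts] only through the events l < npts, so npts = n is written as n - 1 <
   npts without n < npts, the first condition being void for n = 0. *)
rewrite (_ : _ @^-1` A = \bigcup_(n in A)
    ((if n is m.+1 then [set w | (m < npts (Phi o) w)%N] else setT) `\`
     [set w | (n < npts (Phi o) w)%N] : set T')).
  apply: bigcup_measurable => n _; apply: measurableD; last exact: mltn.
  by case: n => [|m]; [exact: measurableT|exact: mltn].
apply/seteqP; split => [w Aw|w [n An [h1 /negP h2]]].
  exists (npts (Phi o) w) => //; split => /=; last by rewrite ltnn.
  by case E : (npts (Phi o) w) => [|m]//=; rewrite E.
rewrite /= (_ : npts (Phi o) w = n)//; apply/eqP; rewrite eqn_leq leqNgt h2/=.
by case: n An h1 h2.
Qed.

Let mpt' o l : measurable_fun [set: T'] (pt (Phi' o) l).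
Proof.
move=> _ A mA; rewrite setTI.
rewrite (_ : _ @^-1` A = [set w | (l < npts (Phi o) w)%N /\ A (pt (Phi o) l w)]
  `|`
  (~` [set w | (l < npts (Phi o) w)%N] `&` [set w | A (0, 0, 0)])).
  apply: measurableU; first exact: mpts.
  apply: measurableI; first by apply: measurableC; exact: mltn.
  have [A0|A0] := pselect (A (0, 0, 0)).
    by rewrite (_ : [set w | _] = setT)//; apply/seteqP; split.
  by rewrite (_ : [set w | _] = set0)//; apply/seteqP; split.
apply/seteqP; split => w /=.
  by case: ifPn => ln Aw; [left|right; split => //; apply/negP].
by case: ifPn => ln [[]//|[]].
Qed.

Let mH' o l : measurable_fun [set: T'] (H' o l).
Proof.
rewrite /H'; case: ifPn => // olk.
move=> _ A mA; rewrite setTI; apply: (@memG (Some (o, l))) => //.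
by exists A => //; rewrite setTI.
Qed.

Let pt'E o l w : (l < npts (Phi o) w)%N -> pt (Phi' o) l w = pt (Phi o) l w.
Proof. by move=> /= ->. Qed.

Let visible'E o l w : (l < npts (Phi o) w)%N ->
  visible S Phi' o l w = visible S Phi o l w.
Proof. by move=> lw; rewrite /visible pt'E. Qed.

Let user_visible'E : user_visible S Phi' = user_visible S Phi.
Proof.
apply/seteqP; split => w /user_visibleP[l vl]; apply/user_visibleP; exists l.
  by rewrite -visible'E.
by rewrite visible'E.
Qed.

Let served'E w : served S Phi' w = served S Phi w.
Proof.
pose g (p : 'I_(npts (Phi Us) w) -> pt3 R) : nat :=
  if [pick l | p l \in cap S Us] is Some l0
  then [arg min_(l < l0 | p l \in cap S Us) dist S (p l)]%O else 0%N.
rewrite -[LHS]/(g (fun l => pt (Phi' Us) l w)) -[RHS]/(g (fun l => pt (Phi Us)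
  l w)).
by congr g; apply/funext => l; rewrite pt'E.
Qed.

Let side_power'E o l w : (l < npts (Phi o) w)%N -> (o, l) != (Us, k) ->
  side_power S Phi' H' o l w = side_power S Phi H o l w.
Proof. by move=> lw olk; rewrite /side_power pt'E// /H' (negbTE olk). Qed.

(** The sum omits the served label, so the fading set to 0 in [H'] is never read. *)
Let I_s'E w : served S Phi w = k -> I_s S Phi' H' w = I_s S Phi H w.
Proof.
move=> sk; rewrite /I_s served'E sk.
transitivity (\sum_(l < npts (Phi Us) w | visible S Phi Us l w && (val l != k))
    side_power S Phi' H' Us l w).
  by apply: eq_bigl => l; rewrite visible'E.
by apply: eq_bigr => l /andP[_ lk]; rewrite side_power'E.
Qed.

Let I_t'E o w : I_t S Phi' H' o w = I_t S Phi H o w.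
Proof.
rewrite /I_t.
transitivity (\sum_(l < npts (Phi (terrestrial o)) w | visible S Phi
  (terrestrial o) l w)
    side_power S Phi' H' (terrestrial o) l w).
  by apply: eq_bigl => l; rewrite visible'E.
by apply: eq_bigr => l _; rewrite side_power'E//; case: o l.
Qed.

Let mG A : measurable (A : set T') -> measurable (A : set T).
Proof.
apply: smallest_sub; first exact: sigma_algebra_measurable.
move=> B [i _]; case: i => [[n l]|] /=.
  by move=> [C mC <-]; exact: mH.
apply: smallest_sub; first exact: sigma_algebra_measurable.
move=> _ [n [l [C [mC ->]]]].
rewrite (_ : [set w | _] = [set w | (l < npts (Phi n) w)%N] `&` pt (Phi n) l
  @^-1` C)//.
apply: measurableI.
  rewrite (_ : [set w | _] = setT `&` npts (Phi n) @^-1` [set m | (l < m)%N]);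
    last by rewrite setTI.
  exact: mN.
by rewrite -[X in measurable X]setTI; exact: mpt.
Qed.

(** The events of [T'] are independent of the fading of label [k], and every event that the distance
    and the interference define inside [served_event k] is one of them; hence [indep_tail]
    applies. *)
Lemma served_tail (o : mode) (phi : R * R -> R) :
  measurable_fun [set: R * R] phi ->
  (P (served_event k `&`
     [set w | (phi (serving_dist S Phi w, interference o w) < H Us k w)%R]) =
  \int[P]_(w in served_event k)
     P [set w' | (phi (serving_dist S Phi w, interference o w) < H Us k
       w')%R])%E.
Proof.
move=> mphi.
pose Y w := phi (serving_dist S Phi w, interference o w).
have mY : measurable_fun [set: T] Y.
  apply: (measurableT_comp mphi); apply: measurable_fun_pair.
    exact: measurable_serving_dist.
  exact: measurable_interference.
apply: (indep_tail (Y := Y) (h := H Us k)) => //.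
  exact: measurable_served_event.
move=> A B mA mB.
have [_ _ _ hind] := hnet.
apply: (mutually_independent_compl (i0 := Some (Us, k)) _ _ _ hind).
- move=> [[n l]|] C /=; first by move=> [D mD <-]; exact: mH.
  by move=> sC; apply: mG; apply: (@memG None).
- move=> [[n l]|] C D /=.
    move=> [C' mC <-] [D' mD <-]; exists (C' `&` D'); first exact: measurableI.
    by rewrite !setTI preimage_setI.
  exact: (@measurableI _ (g_sigma_algebraType _)).
- move=> [[n l]|] /=; first by exists setT => //; rewrite setTI preimage_setT.
  exact: (@measurableT _ (g_sigma_algebraType _)).
(* [Y'] is measurable over [T'] and coincides with [Y] on [served_event k], where alone it is
   compared. *)
- pose Y' (w : T') := phi (serving_dist S Phi' w,
    I_s S Phi' H' w + I_t S Phi' H' o w + sigma2 S).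
  have mY' : measurable_fun [set: T'] Y'.
    apply: (measurableT_comp mphi); apply: measurable_fun_pair.
      exact: (measurable_serving_dist S mN' mpt').
    apply: measurable_funD => //; apply: measurable_funD.
      exact: (measurable_I_s S mN' mpt' mH').
    exact: (measurable_I_t S mN' mpt' mH').
  rewrite (_ : served_event k `&` Y @^-1` A =
    user_visible S Phi' `&` (setT `&` served S Phi' @^-1` [set k]) `&` (setT
      `&` Y' @^-1` A)).
    apply: (@measurableI _ T'); last exact: mY'.
    apply: measurableI; first exact: (measurable_user_visible S mN' mpt').
    by apply: (measurable_served S mN' mpt').
  rewrite user_visible'E !setTI.
  apply/seteqP; split => w [[Vw /= sk] Yw]; split.
  - by split => //=; rewrite served'E.
  - move: Yw; rewrite /Y /Y' /= I_t'E I_s'E// /serving_dist served'E pt'E//.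
    exact: served_ltn.
  - by split => //=; rewrite -served'E.
  - rewrite served'E in sk; move: Yw.
    rewrite /Y /Y' /= I_t'E I_s'E// /serving_dist served'E pt'E//.
    exact: served_ltn.
- by exists B => //; rewrite setTI.
Qed.

End FixedLabel.
End ServedTail.

Section Assembly.
Context {R : realType} (S : params R) (hS : valid_params S).
Context d (T : measurableType d) (P : probability T R).
Variables (Phi : node -> point_process T R) (H : node -> nat -> T -> R).
Hypothesis hnet : network S P Phi H.
Variable o : mode.

Let mN : forall o, measurable_fun [set: T] (npts (Phi o)).
Proof. by case: (network_measurable hnet). Qed.
Let mpt : forall o l, measurable_fun [set: T] (pt (Phi o) l).
Proof. by case: (network_measurable hnet). Qed.
Let mH : forall o l, measurable_fun [set: T] (H o l).
Proof. by case: (network_measurable hnet). Qed.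

Let H_ge0 n l w : 0 <= H n l w.
Proof. by have [_ _ /(_ n l)[_ h _] _] := hnet; exact: h. Qed.

Let V := user_visible S Phi.
Let D := serving_dist S Phi.
Let I := interference S Phi H o.

Let mV : measurable V. Proof. exact: measurable_user_visible. Qed.
Let mD : measurable_fun [set: T] D. Proof. exact: measurable_serving_dist. Qed.
Let mI : measurable_fun [set: T] I. Proof. exact: (measurable_interference
  hnet). Qed.

Let sigma0 : 0 < sigma2 S. Proof. by have [_ _ _ _ []] := hS. Qed.
Let Ptx0 n : 0 < Ptx S n. Proof. by have [_ _ _ _ []] := hS. Qed.

Let free_space_gt0 : 0 < free_space S.
Proof.
have [_ [fc0 c00] _ _ _] := hS.
rewrite /free_space exprn_gt0//; apply: divr_gt0 => //.
by apply: mulr_gt0 => //; apply: mulr_gt0 => //; exact: pi_gt0.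
Qed.

Lemma G1_Ptx_gt0 : 0 < G1 S * Ptx S Us.
Proof.
have [_ _ [[s0 _] [u0 _] _ _ _] _ _] := hS.
by apply: mulr_gt0 (Ptx0 Us); apply: mulr_gt0 free_space_gt0; exact: mulr_gt0.
Qed.

Lemma side_gain_ge0 n u : 0 <= side_gain S n u.
Proof.
have [_ _ [[_ /ltW s0] [_ /ltW s1] [/ltW s2 /ltW s3] /ltW s4 _] _ _] := hS.
rewrite /side_gain; apply: mulr_ge0 (ltW free_space_gt0); apply: mulr_ge0 => //.
by case: n => //; rewrite /Gb_side; case: ifP => // _; case: ifP.
Qed.

Lemma side_power_ge0 n l w : 0 <= side_power S Phi H n l w.
Proof.
rewrite /side_power; apply: mulr_ge0 (powR_ge0 _ _); apply: mulr_ge0 => //.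
by apply: mulr_ge0; [exact: side_gain_ge0|exact: ltW].
Qed.

Lemma I_up_gt0 r w : 0 < I_up S Phi H o r w.
Proof.
rewrite /I_up ltr_wpDl// addr_ge0//; apply: sumr_ge0 => l _; exact:
  side_power_ge0.
Qed.

Lemma interference_gt0 w : 0 < I w.
Proof.
rewrite /I /interference ltr_wpDl// addr_ge0//; apply: sumr_ge0 => l _; exact:
  side_power_ge0.
Qed.

Lemma serving_dist_itv w : V w -> Rmin S Us <= D w <= Rmax S Us.
Proof.
move=> /servedP[_ /set_mem[sw dw] _]; rewrite /D /serving_dist dist_ge_Rmin//.
Qed.

Let Rmin0 : 0 < Rmin S Us. Proof. exact: Rmin_gt0. Qed.

(* The fading threshold above which the SINR exceeds [g], as a function of the
   serving distance and the interference. *)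
Definition threshold (g : R) (u : R * R) : R :=
  g * u.1 `^ alpha S / (G1 S * Ptx S Us) * u.2.

Lemma measurable_threshold g : measurable_fun [set: R * R] (threshold g).
Proof.
rewrite /threshold; apply: measurable_funM; last exact: measurable_snd.
apply: measurable_funM => //; apply: measurable_funM => //.
exact: (measurableT_comp (@measurable_powR R _) measurable_fst).
Qed.

Lemma threshold_ge0 g r y : 0 <= g -> 0 <= y -> 0 <= threshold g (r, y).
Proof.
move=> g0 y0; rewrite /threshold/= mulr_ge0// divr_ge0 ?(ltW G1_Ptx_gt0)//.
by rewrite mulr_ge0// powR_ge0.
Qed.

Lemma SINR_gt g w : V w ->
  (g < SINR S Phi H o w) = (threshold g (D w, I w) < H Us (served S Phi w) w).
Proof.
move=> Vw; rewrite /SINR mem_set//.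
have Iw := interference_gt0 w; rewrite /I /interference in Iw.
have D0 : 0 < D w.
  by apply: lt_le_trans Rmin0 _; have /andP[] := serving_dist_itv Vw.
have a0 : 0 < D w `^ alpha S by rewrite powR_gt0.
rewrite ltr_pdivlMr// powRN ltr_pdivlMr// /threshold/=.
rewrite [X in _ = (X < _)]mulrAC ltr_pdivrMr ?G1_Ptx_gt0//.
by rewrite mulrAC [X in _ = (_ < X)]mulrC.
Qed.

Lemma SINR_ge0 w : 0 <= SINR S Phi H o w.
Proof.
rewrite /SINR; case: ifPn => // _; rewrite divr_ge0 ?(ltW (interference_gt0
  w))//.
by rewrite mulr_ge0 ?powR_ge0// mulr_ge0// (ltW G1_Ptx_gt0).
Qed.

Let h0 : {RV P >-> R} := HB.pack (H Us 0%N) (isMeasurableFun.Build _ _ _ _ _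
  (mH Us 0%N)).

(** Label 0 represents all labels, which share this tail. A probability is taken, rather than 1 -
    [sr_cdf], to have a nonnegative function on the whole line: the closed form is the tail for t >=
    0 only. *)
Definition fading_ccdf (t : R) : R := fine (P [set w | t < H Us 0%N w]).

Let ccdfE t : ccdf h0 t = P [set w | t < H Us 0%N w].
Proof.
rewrite /ccdf /distribution /pushforward; congr (P _).
by apply/seteqP; split => w /=; rewrite in_itv/= andbT.
Qed.

Let mtail n l t : measurable [set w | t < H n l w].
Proof.
rewrite (_ : [set w | _] = setT `&` H n l @^-1` `]t, +oo[); first exact: mH.
by rewrite setTI; apply/seteqP; split => w /=; rewrite in_itv/= andbT.
Qed.

Let fading_ccdfE t : (fading_ccdf t)%:E = ccdf h0 t.
Proof. by rewrite /fading_ccdf fineK ?ccdfE// fin_num_measure. Qed.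

Lemma measurable_fading_ccdf : measurable_fun [set: R] fading_ccdf.
Proof.
apply/measurable_EFinP; rewrite (_ : EFin \o _ = ccdf h0); last first.
  by apply/funext => t /=; rewrite fading_ccdfE.
exact: ccdf_measurable.
Qed.

Lemma fading_ccdf_ge0 t : 0 <= fading_ccdf t.
Proof. exact: fine_ge0. Qed.

Lemma fading_ccdf_sr t : 0 <= t -> fading_ccdf t = 1 - sr_cdf S t.
Proof.
move=> t0; have [_ _ _ [b0 O0 m0] _] := hS; have [_ _ hH _] := hnet.
by rewrite /fading_ccdf (fading_tail b0 O0 m0 (hH Us 0%N))//.
Qed.

Lemma prob_fading_gt l t : 0 <= t ->
  P [set w | t < H Us l w] = (fading_ccdf t)%:E.
Proof.
move=> t0; have [_ _ _ [b0 O0 m0] _] := hS; have [_ _ hH _] := hnet.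
by rewrite fading_ccdf_sr// (fading_tail b0 O0 m0 (hH Us l)).
Qed.

(** The events [served_event k] partition [V]. On each of them [served_tail] applies, and since the
    tail is the same for every label the pieces recombine into one integral. *)
Lemma prob_SINR_gt g : 0 < g ->
  (P [set w | g < SINR S Phi H o w]%R =
   \int[P]_(w in V) (fading_ccdf (threshold g (D w, I w)))%:E)%E.
Proof.
move=> g0.
pose E := served_event S Phi.
have mE k : measurable (E k) by exact: (measurable_served_event hnet).
have EV : V = \bigcup_k E k.
  by apply/seteqP; split => [w Vw|w [k _ []]//]; exists (served S Phi w).
have tE : trivIset setT E.
  by apply/trivIsetP => i j _ _ ij; apply/seteqP; split => w // [[_ /= si] [_
    /= sj]];
    move: ij; rewrite -si -sj eqxx.
have mth : measurable_fun [set: T] (fun w => fading_ccdf (threshold g (D w, I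
  w))).
  apply: (measurableT_comp measurable_fading_ccdf).
  apply: (measurableT_comp (measurable_threshold g)).
  exact: measurable_fun_pair.
pose A k := E k `&` [set w | threshold g (D w, I w) < H Us k w].
have mA k : measurable (A k).
  apply: measurableI => //.
  rewrite (_ : [set w | _] = setT `&` (fun w => threshold g (D w, I w) < H Us k
    w) @^-1` [set true]).
    apply: measurable_fun_ltr => //; apply: (measurableT_comp
      (measurable_threshold g)).
    exact: measurable_fun_pair.
  by rewrite setTI; apply/seteqP; split.
rewrite (_ : [set w | _] = \bigcup_k A k); last first.
  apply/seteqP; split => [w /= gw|w [k _ [[Vw /= sk]]]] /=.
    (* With no visible user the SINR is 0, which does not exceed g > 0. *)
    have Vw : V w.
      move: gw; rewrite /SINR; case: ifPn => [/set_mem//|_].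
      by rewrite ltNge (ltW g0).
    by exists (served S Phi w) => //; split => //=; rewrite -SINR_gt.
  by rewrite SINR_gt// sk.
rewrite measure_semi_bigcup//; last 2 first.
- apply/trivIsetP => i j _ _ ij; rewrite /A setIACA.
  by move/trivIsetP : tE => /(_ _ _ _ _ ij) ->//; rewrite set0I.
- exact: bigcupT_measurable.
rewrite EV ge0_integral_bigcup//; last 2 first.
- by apply/measurable_EFinP; exact: measurable_funTS.
- by move=> w _; rewrite lee_fin fading_ccdf_ge0.
apply: eq_eseriesr => k _.
apply: (etrans (served_tail hnet k o (measurable_threshold g))).
apply: eq_integral => w _; apply: prob_fading_gt.
by apply: threshold_ge0; [exact: ltW|exact: (ltW (interference_gt0 w))].
Qed.

(* Holds off the event of two visible users at the same distance. *)
Lemma interference_I_up_ae : exists N, [/\ measurable N, P N = 0%E &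
  forall w, V w -> ~ N w -> I w = I_up S Phi H o (D w) w].
Proof.
have [hPhi _ _ _] := hnet.
have [N [mN0 PN0 Nties]] := ties_negligible hS hPhi Us.
exists N; split => // w Vw Nw; have [sN vs smin] := servedP Vw.
rewrite /I /interference /I_up /I_s; congr (_ + _ + _).
apply: eq_bigl => l; rewrite in_setD /visible.
case: (boolP (_ \in cap S Us)) => //= cl; rewrite mem_cap_upto// -ltNge.
apply/idP/idP => [lsrv|].
  rewrite lt_neqAle smin ?ltn_ord// andbT; apply/negP => /eqP dl; apply: Nw.
  by apply: (Nties w (served S Phi w) l) => //; rewrite eq_sym.
by apply: contraTN => /eqP ->; rewrite ltxx.
Qed.

End Assembly.

Section Conditioning.
Context {R : realType} (S : params R) (hS : valid_params S).
Context d (T : measurableType d) (P : probability T R).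
Variables (Phi : node -> point_process T R) (H : node -> nat -> T -> R).
Hypothesis hnet : network S P Phi H.
Variables (o : mode) (f : R -> R) (kappa : R.-pker R ~> R).
Hypothesis hf : is_nearest_density S P Phi f.

Let V := user_visible S Phi.
Let D := serving_dist S Phi.
Let Y w := I_up S Phi H o (D w) w.

Hypothesis hk : is_cond_law P V D Y kappa.

Let mN : forall o, measurable_fun [set: T] (npts (Phi o)).
Proof. by case: (network_measurable hnet). Qed.
Let mpt : forall o l, measurable_fun [set: T] (pt (Phi o) l).
Proof. by case: (network_measurable hnet). Qed.
Let mH : forall o l, measurable_fun [set: T] (H o l).
Proof. by case: (network_measurable hnet). Qed.
Let mV : measurable V. Proof. exact: measurable_user_visible. Qed.
Let mD : measurable_fun [set: T] D. Proof. exact: measurable_serving_dist. Qed.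
Let mY : measurable_fun [set: T] Y. Proof. exact: measurable_I_up. Qed.

Local Notation Icap := (`[Rmin S Us, Rmax S Us]%classic : set R).

Let tail (g : R) (u : R * R) : \bar R := (fading_ccdf P H (threshold S g u))%:E.

Let mtail g : measurable_fun [set: R * R] (tail g).
Proof.
apply/measurable_EFinP; apply: (measurableT_comp (measurable_fading_ccdf hnet)).
exact: measurable_threshold.
Qed.

Let tail_ge0 g u : (0 <= tail g u)%E.
Proof. by rewrite lee_fin fading_ccdf_ge0. Qed.

(** A version of the conditional probability that the SINR exceeds g, given [V] and the serving
    distance r. *)
Definition cond_ccdf (g r : R) : \bar R := (\int[kappa r]_y tail g (r, y))%E.

Lemma measurable_cond_ccdf g : measurable_fun [set: R] (cond_ccdf g).
Proof. exact: (@measurable_fun_integral_finite_kernel _ _ _ _ _ (tail g) kappa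
  (tail_ge0 g) (mtail g)). Qed.

Lemma cond_ccdf_ge0 g r : (0 <= cond_ccdf g r)%E.
Proof. exact: integral_ge0. Qed.

Lemma prob_SINR_gt_cond g : 0 < g ->
  (P [set w | g < SINR S Phi H o w]%R =
   P V * \int[lebesgue_measure]_(r in Icap) (cond_ccdf g r * (f r)%:E))%E.
Proof.
move=> g0; rewrite prob_SINR_gt//.
have [N [mN0 PN0 NE]] := interference_I_up_ae hS hnet o.
transitivity (\int[P]_(w in V) tail g (D w, Y w))%E.
  apply: (eq_integral_off_null mN0 PN0) => w Vw Nw.
  by rewrite /tail (NE w Vw Nw).
rewrite (integral_cond_law mV mD mY hk (f := tail g))//.
(* On [V] the serving distance lies in [Icap], so the indicator is free here; it confines the
   Lebesgue integral to the range in the statement. *)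
pose K r := (cond_ccdf g r * (\1_Icap r)%:E)%E.
transitivity (\int[P]_(w in V) K (D w))%E.
  apply: eq_integral => w /set_mem Vw; rewrite /K indicE mem_set ?mule1//.
  by rewrite /= in_itv/=; exact: (serving_dist_itv hS).
rewrite (integral_cond_density mV mD hf (g := K)).
- congr (_ * _)%E; rewrite [RHS]integral_mkcond; apply: eq_integral => r _.
  rewrite patchE /K indicE; case: ifPn => rI; first by rewrite mule1.
  by rewrite mule0 mul0e.
- by move=> r; rewrite mule_ge0 ?cond_ccdf_ge0// lee_fin.
- apply: emeasurable_funM; first exact: measurable_cond_ccdf.
  apply/measurable_EFinP.
  exact: measurable_indic.
Qed.

Local Notation neg := (`]-oo, (0 : R)%R[%classic : set R).

(** Interference plus noise is positive, so P(V) times the integral of [kappa r neg] against [f] is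
    P(V and Y < 0) = 0. As P(V) > 0, the nonnegative product [kappa r neg] f(r) vanishes almost
    everywhere. *)
Lemma kappa_neg_null : exists N : set (measurableTypeR R), [/\ measurable N,
  lebesgue_measure N = 0%E &
  forall r, ~ N r -> f r = 0 \/ kappa r neg = 0%E].
Proof.
have [mf f0 _] := hf.
have mneg0 : measurable neg by exact: measurable_itv.
have mneg : measurable_fun [set: R] (fun r => kappa r neg).
  exact: measurable_kernel.
have PV0 : (0 < P V)%E.
  by apply: (prob_user_visible_gt0 hS); case: hnet.
have I0 : (\int[lebesgue_measure]_r (kappa r neg * (f r)%:E) = 0)%E.
  have := integral_cond_density mV mD hf (g := fun r => kappa r neg)
    (fun r => measure_ge0 _ _) mneg.
  have := hk measurableT (mneg0).
  rewrite preimage_setT setIT => ->.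
  rewrite (_ : _ `&` _ = set0) ?measure0.
    move=> /esym/eqP; rewrite mule_eq0 (gt_eqF PV0)/= => /eqP; exact.
  apply/seteqP; split => // w [_ /=]; rewrite in_itv/= ltNge.
  by rewrite (ltW (I_up_gt0 hS hnet o _ w)).
have mg : measurable_fun [set: measurableTypeR R]
    (fun r : measurableTypeR R => (kappa r neg * (f r)%:E)%E).
  by apply: emeasurable_funM => //; exact/measurable_EFinP.
have /ae_eq_integral_abs : (\int[lebesgue_measure]_(r in [set: measurableTypeR
  R]) `|kappa r neg * (f r)%:E| = 0)%E.
  rewrite -[RHS]I0; apply: eq_integral => r _.
  by rewrite gee0_abs// mule_ge0// lee_fin.
move=> /(_ measurableT mg)[N [mN0 N0 hN]]; exists N; split => // r Nr.
have : ~ ~ ([set: R] r -> (kappa r neg * (f r)%:E = cst 0 r)%E).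
  by move=> h; apply: Nr; exact: hN.
move=> /contrapT /(_ Logic.I)/eqP; rewrite mule_eq0 => /orP[/eqP->|]; first by
  right.
by rewrite eqe => /eqP; left.
Qed.

End Conditioning.

Theorem theorem1 (R : realType) (S : params R) (hS : valid_params S)
  (d : measure_display) (T : measurableType d) (P : probability T R)
  (Phi : node -> point_process T R) (H : node -> nat -> T -> R)
  (hnet : network S P Phi H)
  (o : mode)
  (f : R -> R) (hf : is_nearest_density S P Phi f)
  (L : R -> R -> R) (hL : is_interference_laplace S P Phi H o L) :
  spectral_efficiency S P Phi H o =
  ((1 - expR (- (lamt S Us * pi * (Rmax S Us ^+ 2 - Rmin S Us ^+ 2))))%:E *
   \int[lebesgue_measure]_(gamma in `]0%R, +oo[)
     \int[lebesgue_measure]_(r in `[Rmin S Us, Rmax S Us])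
       ((1 - \sum_(z < ms S)
               zeta S z * Gamma (z.+1)%:R / (beta S - sr_c S) ^+ z.+1 *
               (1 - \sum_(v < z.+1)
                      ((beta S - sr_c S) * gamma * r `^ alpha S) ^+ v
                      / ((G1 S * Ptx S Us) ^+ v * v`!%:R) * (-1) ^+ v *
                      derive1n v (L r)
                        ((beta S - sr_c S) * gamma * r `^ alpha S
                         / (G1 S * Ptx S Us))))
        * f r * (log2 (expR 1) / (1 + gamma)))%:E)%E.
Proof.
have [kappa hk LE] := hL.
have [mf f0 _] := hf.
have [_ _ _ [b0 O0 m0] _] := hS.
have k0 := sr_rate_gt0 b0 O0 m0; have GP0 := G1_Ptx_gt0 hS.
have Rmin0 := Rmin_gt0 hS Us.
have PVE : P (user_visible S Phi) =
    (1 - expR (- (lamt S Us * pi * (Rmax S Us ^+ 2 - Rmin S Us ^+ 2))))%:E.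
  by rewrite (prob_user_visible hS)//; case: hnet.
have [mN mpt mH] := network_measurable hnet.
have mSINR : measurable_fun [set: T] (SINR S Phi H o) by exact: measurable_SINR.
have [N [mN0 N0 hN]] := kappa_neg_null hS hnet hf hk.
rewrite /spectral_efficiency (expectation_log2 P mSINR (SINR_ge0 hS hnet o))
  -PVE.
pose w (g : R) : R := log2 (expR 1) / (1 + g).
have w0 g : 0 <= g -> 0 <= w g.
  move=> g0; rewrite /w log2_expR1 divr_ge0 ?addr_ge0// invr_ge0 ln_ge0//.
  by rewrite ler1n.
have inner g : 0 < g ->
  (\int[lebesgue_measure]_(r in `[Rmin S Us, Rmax S Us])
       ((1 - \sum_(z < ms S)
               zeta S z * Gamma (z.+1)%:R / (beta S - sr_c S) ^+ z.+1 *
               (1 - \sum_(v < z.+1)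
                      ((beta S - sr_c S) * g * r `^ alpha S) ^+ v
                      / ((G1 S * Ptx S Us) ^+ v * v`!%:R) * (-1) ^+ v *
                      derive1n v (L r)
                        ((beta S - sr_c S) * g * r `^ alpha S
                         / (G1 S * Ptx S Us))))
        * f r * (log2 (expR 1) / (1 + g)))%:E =
   (w g)%:E * \int[lebesgue_measure]_(r in `[Rmin S Us, Rmax S Us]%classic :
     set R)
     (cond_ccdf S P H kappa g r * (f r)%:E))%E.
  move=> g0; rewrite -ge0_integralZl_EFin ?w0 ?(ltW g0)//; last 2 first.
  - by move=> r _; rewrite mule_ge0 ?lee_fin// cond_ccdf_ge0.
  - apply: (measurable_funS measurableT) => //; apply: emeasurable_funM.
      exact: (measurable_cond_ccdf hnet).
    exact/measurable_EFinP.
  apply: (eq_integral_off_null mN0 N0) => r; rewrite /= in_itv/= => /andP[rmin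
    rmax] Nr.
  (* Where [f r] = 0 both integrands vanish, whatever [kappa r] and [L r] are; otherwise [kappa r]
     lives on the nonnegative reals. *)
  have [fr0|kr0] := hN r Nr.
    by rewrite fr0 mulr0 mul0r mule0 mule0.
  have r0 : 0 < r by exact: lt_le_trans rmin.
  (* The slope of the fading threshold in the interference: [threshold S g (r, y)] is c y, so the
     derivatives are taken at (beta - c_sr) c, with c_sr standing for [sr_c]. *)
  pose c := g * r `^ alpha S / (G1 S * Ptx S Us).
  have c0 : 0 < c by rewrite /c divr_gt0// mulr_gt0// powR_gt0.
  have mg : measurable_fun [set: R] (fading_ccdf P H) by exact:
    (measurable_fading_ccdf hnet).
  have pk : kappa r [set: R] = 1%E by rewrite prob_kernel.
  have ccdfE : cond_ccdf S P H kappa g r = _ :=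
    @integral_mixed_tail R (kappa r) pk kr0 (L r) (LE r) (ms S)
      (fun z => zeta S z * z`!%:R / (beta S - sr_c S) ^+ z.+1) (beta S - sr_c
        S) c
      (fading_ccdf P H) k0 c0 mg (fading_ccdf_ge0 P H)
      (fun y y0 => fading_ccdf_sr hS hnet y0).
  rewrite ccdfE -!EFinM; congr (_%:E).
  rewrite [LHS]mulrC; congr (_ * (_ * _)); congr (1 - _).
  apply: eq_bigr => z _; rewrite Gamma_nat; congr (_ * (1 - _)).
  have cE : (beta S - sr_c S) * g * r `^ alpha S / (G1 S * Ptx S Us) = (beta S
    - sr_c S) * c.
    by rewrite /c !mulrA.
  apply: eq_bigr => v _; rewrite cE; congr (_ * _ * _).
  by rewrite -cE expr_div_n invfM mulrA.
pose p := fine (P (user_visible S Phi)).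
have PVp : P (user_visible S Phi) = p%:E.
  by rewrite fineK// fin_num_measure//; exact: measurable_user_visible.
have p0 : 0 < p.
  by rewrite -lte_fin -PVp; apply: (prob_user_visible_gt0 hS); case: hnet.
pose F (g : R) : \bar R := ((w g)%:E * P [set w | (g < SINR S Phi H o w)%R])%E.
(* The inner integral is the tail of the SINR divided by p, times the weight. Written as p^-1 F, its
   measurability in g comes from that of the tail function, and p > 0 cancels outside. *)
transitivity (p%:E * \int[lebesgue_measure]_(g in `]0%R, +oo[) (p^-1%:E * F
  g))%E; last first.
  rewrite PVp; congr (_ * _)%E; apply: eq_integral => g /set_mem; rewrite /=
    in_itv/= andbT => g0.
  rewrite inner// /F (prob_SINR_gt_cond hS hnet hf hk g0) PVp.
  rewrite [LHS]muleCA; congr (_ * _)%E.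
  by rewrite muleA -EFinM mulVf ?gt_eqF// mul1e.
rewrite ge0_integralZl_EFin ?invr_ge0 ?(ltW p0)//.
- by rewrite muleA -EFinM divff ?gt_eqF// mul1e.
- move=> g; rewrite /= in_itv/= andbT => g0.
  by rewrite /F mule_ge0 ?lee_fin ?w0 ?(ltW g0).
- apply: (measurable_funS measurableT) => //; apply: emeasurable_funM.
    apply/measurable_EFinP; apply: measurable_funM => //.
    by apply: (measurableT_comp measurable_inv); exact: measurable_funD.
  pose X : {RV P >-> R} := HB.pack (SINR S Phi H o) (isMeasurableFun.Build _ _
    _ _ _ mSINR).
  rewrite (_ : (fun g => _) = ccdf X); first exact: ccdf_measurable.
  apply/funext => g; rewrite /ccdf /distribution /pushforward; congr (P _).
  by apply/seteqP; split => x /=; rewrite in_itv/= andbT.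
Qed.
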